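(* Let $1\leq a<n$ be integers, let $G=C_{2n}(a,n)$ be the corresponding circulant cubic graph, and let $t=\gcd(a,2n)$. Then $G$ is $S_2$ if and only if $\frac{2n}{t}\in\{3,4,5,8\}$.
   Context: For an integer $m\geq 1$ and $S\subseteq\{1,2,\ldots,\lfloor m/2\rfloor\}$, the circulant graph $C_m(S)$ has vertex set $\{0,1,\ldots,m-1\}$ and edge set $\{\{i,j\} : |i-j|\in S \text{ or } m-|i-j|\in S\}$. One writes $C_m(a_1,\ldots,a_t)$ for $C_m(\{a_1,\ldots,a_t\})$. A cubic graph is one in which every vertex has degree $3$; circulant cubic graphs are exactly those of the form $C_{2n}(a,n)$ with $1\leq a<n$. The independence complex $\mathrm{Ind}(G)$ of a finite simple graph $G$ is the simplicial complex whose faces are the independent sets of $G$ (including the empty set). A simplicial complex $\Delta$ satisfies Serre's condition $S_2$ (over a field $k$) if its Stanley-Reisner ring $R=k[\Delta]$ satisfies $\mathrm{depth}(R_p)\geq\min\{2,\dim R_p\}$ for all primes $p$. It is known that this holds if and only if $\mathrm{link}_\Delta(F)$ is connected for every face $F\in\Delta$ (including $F=\emptyset$) with $\dim\mathrm{link}_\Delta(F)\geq 1$, where $\mathrm{link}_\Delta(F)=\{H\in\Delta : H\cap F=\emptyset,\ H\cup F\in\Delta\}$; in particular it does not depend on $k$. A graph $G$ is called $S_2$ if $\mathrm{Ind}(G)$ satisfies $S_2$. *)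

(* Defs.v *)
From HB Require Import structures.
From mathcomp Require Import all_boot all_algebra.
From mathcomp Require Import ring_quotient boolp.
From mathcomp Require Import mpoly ring.

Set Implicit Arguments.
Unset Strict Implicit.
Unset Printing Implicit Defensive.

Import GRing.Theory.
Local Open Scope ring_scope.
Local Open Scope quotient_scope.

(* Subsets of a ring are boolean predicates, as in ring_quotient.  With the   *)
(* axioms of boolp every subset is of this form, so that [prime_idealr R]     *)
(* ranges over all the prime ideals of R.                                     *)

Module Localization.
Section Localization.
Variables (R : comNzRingType) (p : prime_idealr R).
Local Notation I := (p : {pred R}).

Definition frac : Type := R * {s : R | s \notin I}.

Implicit Types (x y z : frac).
Definition den x : R := val x.2.

Lemma denP x : den x \notin I. Proof. exact: valP x.2. Qed.

Lemma notinM (s t : R) : s \notin I -> t \notin I -> s * t \notin I.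
Proof. by move=> hs ht; rewrite prime_idealrM negb_or hs. Qed.

Lemma notin1 : 1 \notin I. Proof. by rewrite idealr1. Qed.

Definition mkfrac (a s : R) (hs : s \notin I) : frac := (a, exist _ s hs).

(* a / s = b / t iff u (a t - b s) = 0 for some u outside p; the factor u is  *)
(* needed since R may have zero divisors.                                     *)
Definition equivf x y : bool :=
  `[< exists2 u : R, u \notin I & u * (x.1 * den y) = u * (y.1 * den x) >].

Lemma equivf_is_equiv : equiv_class_of equivf.
Proof.
split=> [x|x y|y x z].
- by apply/asboolP; exists 1; rewrite ?notin1.
- by apply/asboolP/asboolP => -[u hu e]; exists u.
- move=> /asboolP[u hu e1] /asboolP[v hv e2]; apply/asboolP.
  exists (u * v * den y); first by rewrite !notinM ?denP.
  have -> : u * v * den y * (x.1 * den z) = v * den z * (u * (x.1 * den y)).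
    by ring.
  have -> : u * v * den y * (z.1 * den x) = u * den x * (v * (z.1 * den y)).
    by ring.
  by rewrite e1 -e2; ring.
Qed.

Canonical equivf_equiv := EquivRelPack equivf_is_equiv.
Canonical equivf_encModRel := defaultEncModRel equivf.

Definition local := {eq_quot equivf}.
#[export] HB.instance Definition _ := EqQuotient.on local.
#[export] HB.instance Definition _ := Choice.on local.

Definition zerof := mkfrac 0 notin1.
Definition onef := mkfrac 1 notin1.
Definition addf x y :=
  mkfrac (x.1 * den y + y.1 * den x) (notinM (denP x) (denP y)).
Definition oppf x := mkfrac (- x.1) (denP x).
Definition mulf x y := mkfrac (x.1 * y.1) (notinM (denP x) (denP y)).

Lemma denE : (den zerof = 1) * (den onef = 1)
  * (forall x y, den (addf x y) = den x * den y)
  * (forall x, den (oppf x) = den x)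
  * (forall x y, den (mulf x y) = den x * den y).
Proof. by []. Qed.

Definition zero : local := lift_cst local zerof.
Definition one : local := lift_cst local onef.
Definition add := lift_op2 local addf.
Definition opp := lift_op1 local oppf.
Definition mul := lift_op2 local mulf.

Canonical pi_zero_morph := PiConst zero.

Lemma reprP x : exists2 u : R, u \notin I &
  u * (x.1 * den (repr (\pi_local x))) = u * ((repr (\pi_local x)).1 * den x).
Proof. by apply/asboolP; rewrite -[`[< _ >]]/(equivf x _) -eqmodE reprK. Qed.

Lemma pi_add : {morph \pi_local : x y / addf x y >-> add x y}.
Proof.
move=> x y; unlock add; apply/eqmodP/asboolP.
have [u hu eu] := reprP x; have [v hv ev] := reprP y.
exists (u * v); first exact: notinM.
move: (repr (\pi x)) (repr (\pi y)) eu ev => x' y' eu ev.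
rewrite /= !denE.
transitivity (den y * den y' * v * (u * (x.1 * den x')) +
              den x * den x' * u * (v * (y.1 * den y'))); first by ring.
by rewrite eu ev; ring.
Qed.
Canonical pi_add_morph := PiMorph2 pi_add.

Lemma pi_opp : {morph \pi_local : x / oppf x >-> opp x}.
Proof.
move=> x; unlock opp; apply/eqmodP/asboolP.
have [u hu eu] := reprP x; exists u => //.
by move: (repr _) eu => x' eu; rewrite /= !denE !mulNr !mulrN eu.
Qed.
Canonical pi_opp_morph := PiMorph1 pi_opp.

Lemma pi_mul : {morph \pi_local : x y / mulf x y >-> mul x y}.
Proof.
move=> x y; unlock mul; apply/eqmodP/asboolP.
have [u hu eu] := reprP x; have [v hv ev] := reprP y.
exists (u * v); first exact: notinM.
move: (repr (\pi x)) (repr (\pi y)) eu ev => x' y' eu ev.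
rewrite /= !denE.
transitivity ((u * (x.1 * den x')) * (v * (y.1 * den y'))); first by ring.
by rewrite eu ev; ring.
Qed.
Canonical pi_mul_morph := PiMorph2 pi_mul.

Lemma eq_local x y : x.1 * den y = y.1 * den x -> x = y %[mod local].
Proof.
by move=> e; apply/eqmodP/asboolP; exists 1; rewrite ?notin1 // e.
Qed.

Lemma addA : associative add.
Proof.
move=> x y z; rewrite -[x]reprK -[y]reprK -[z]reprK !piE.
by apply: eq_local; rewrite /= !denE; ring.
Qed.

Lemma addC : commutative add.
Proof.
move=> x y; rewrite -[x]reprK -[y]reprK !piE.
by apply: eq_local; rewrite /= !denE; ring.
Qed.

Lemma add0 : left_id zero add.
Proof.
move=> x; rewrite -[x]reprK !piE.
by apply: eq_local; rewrite /= !denE; ring.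
Qed.

Lemma addN : left_inverse zero opp add.
Proof.
move=> x; rewrite -[x]reprK !piE.
by apply: eq_local; rewrite /= !denE; ring.
Qed.

#[export] HB.instance Definition _ := GRing.isZmodule.Build local addA addC add0 addN.

Canonical pi_one_morph := PiConst one.

Lemma mulA : associative mul.
Proof.
move=> x y z; rewrite -[x]reprK -[y]reprK -[z]reprK !piE.
by apply: eq_local; rewrite /= !denE; ring.
Qed.

Lemma mulC : commutative mul.
Proof.
move=> x y; rewrite -[x]reprK -[y]reprK !piE.
by apply: eq_local; rewrite /= !denE; ring.
Qed.

Lemma mul1 : left_id one mul.
Proof.
move=> x; rewrite -[x]reprK !piE.
by apply: eq_local; rewrite /= !denE; ring.
Qed.

Lemma mulDl : left_distributive mul add.
Proof.
move=> x y z; rewrite -[x]reprK -[y]reprK -[z]reprK !piE.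
by apply: eq_local; rewrite /= !denE; ring.
Qed.

Lemma one_neq0 : one != 0.
Proof.
rewrite -[0]/zero !piE; apply/asboolP => -[u hu].
by rewrite /= !denE !mulr1 mulr0 => u0; rewrite u0 idealr0 in hu.
Qed.

#[export] HB.instance Definition _ :=
  GRing.Zmodule_isComNzRing.Build local mulA mulC mul1 mulDl one_neq0.

End Localization.
Module Exports. HB.reexport. End Exports.
End Localization.
Export Localization.Exports.

Notation localization := Localization.local.

(* dim A >= n: there is a strict chain P_0 < ... < P_n of prime ideals.       *)
Definition krull_dim_ge (A : comNzRingType) (n : nat) : Prop :=
  exists P : 'I_n.+1 -> prime_idealr A, forall i j : 'I_n.+1, (i < j)%N ->
    {subset (P i : {pred A}) <= (P j : {pred A})} /\
    ~ {subset (P j : {pred A}) <= (P i : {pred A})}.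

Definition in_generated (A : comNzRingType) (s : seq A) (z : A) : Prop :=
  exists c : 'I_(size s) -> A, z = \sum_i c i * s`_i.

Definition regular_sequence (A : comNzRingType) (s : seq A) : Prop :=
  (forall (i : nat) (z : A), (i < size s)%N ->
     in_generated (take i s) (s`_i * z) -> in_generated (take i s) z) /\
  ~ in_generated s 1.

Definition invertible (A : comNzRingType) (x : A) : Prop := exists y, x * y = 1.

(* For a local ring A, whose maximal ideal is the set of its non-units:       *)
(* depth A >= n, where depth A is the supremum of the lengths of the regular  *)
(* sequences in the maximal ideal.                                            *)
Definition depth_ge (A : comNzRingType) (n : nat) : Prop :=
  exists s : seq A, [/\ size s = n, (forall x, x \in s -> ~ invertible x)
    & regular_sequence s].

(* depth R_p >= min(r, dim R_p) for every prime p, the inequality between     *)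
(* (possibly infinite) suprema being tested on all i <= min(r, dim R_p).      *)
Definition serre_condition (r : nat) (R : comNzRingType) : Prop :=
  forall (p : prime_idealr R) (i : nat), (i <= r)%N ->
    krull_dim_ge (localization p) i -> depth_ge (localization p) i.

Record simplicial_complex (V : finType) := SimplicialComplex {
  faces :> {set {set V}};
  faces0 : set0 \in faces;
  facesS : forall F H : {set V}, H \subset F -> F \in faces -> H \in faces
}.

Section StanleyReisner.
Variables (k : fieldType) (N : nat) (D : simplicial_complex 'I_N).

Definition face_monomial (F : {set 'I_N}) : {mpoly k[N]} :=
  \prod_(v in F) 'X_v.

(* The ideal generated by the monomials of the non-faces.                     *)
Definition sr_ideal : {mpoly k[N]} -> bool := fun f =>
  `[< exists c : {set 'I_N} -> {mpoly k[N]},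
        f = \sum_(F | F \notin faces D) c F * face_monomial F >].

Lemma sr_ideal_closed : idealr_closed sr_ideal.
Proof.
split.
- by apply/asboolP; exists (fun=> 0); rewrite big1 // => F _; rewrite mul0r.
- apply/asboolP => -[c /(congr1 (meval (fun=> 0)))].
  rewrite rmorph1 raddf_sum big1 /= => [/eqP|F FD]; first by rewrite oner_eq0.
  have /set0Pn[v vF] : F != set0.
    by apply: contraNneq FD => ->; apply: faces0.
  by rewrite /face_monomial (bigD1 v) //= !rmorphM /= mevalXU mul0r mulr0.
- move=> a f g /asboolP[c ->] /asboolP[d ->]; apply/asboolP.
exists (fun F => a * c F + d F); rewrite mulr_sumr -big_split /=.
by apply: eq_bigr => F _; rewrite mulrDl mulrA.
Qed.

HB.instance Definition _ :=
  isIdealr.Build {mpoly k[N]} sr_ideal sr_ideal_closed.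

Definition stanley_reisner_ring : comNzRingType := {ideal_quot (sr_ideal : idealr {mpoly k[N]})}.

End StanleyReisner.

Section IndependenceComplex.
Variables (V : finType) (e : rel V).

Definition independent (F : {set V}) : bool :=
  [forall u in F, forall v in F, ~~ e u v].

Lemma independent0 : set0 \in [set F | independent F].
Proof. by rewrite inE; apply/forall_inP => u; rewrite inE. Qed.

Lemma independentS (F H : {set V}) : H \subset F ->
  F \in [set F | independent F] -> H \in [set F | independent F].
Proof.
rewrite !inE => /subsetP HF /forall_inP iF; apply/forall_inP => u /HF uF.
by apply/forall_inP => v /HF vF; apply: (forall_inP (iF u uF)).
Qed.

Definition independence_complex : simplicial_complex V :=
  SimplicialComplex independent0 independentS.

End IndependenceComplex.

Definition dist (i j : nat) : nat := (maxn i j - minn i j)%N.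

Definition circulant (m : nat) (S : seq nat) : rel 'I_m :=
  fun i j => (dist i j \in S) || ((m - dist i j)%N \in S).
Arguments circulant : clear implicits.

Lemma circulant_sym m S : ssrbool.symmetric (circulant m S).
Proof. by move=> i j; rewrite /circulant /dist maxnC minnC. Qed.

Lemma circulant_irr m S : (forall s, s \in S -> (0 < s <= m./2)%N) ->
  irreflexive (circulant m S).
Proof.
move=> hS i; rewrite /circulant /dist maxnn minnn subnn subn0.
apply/negbTE; rewrite negb_or; apply/andP; split; apply/negP => /hS //.
by case/andP=> m0; rewrite leqNgt ltn_half_double -addnn -{1}[m]addn0 ltn_add2l m0.
Qed.

Definition graph_serre2 (k : fieldType) (m : nat) (e : rel 'I_m) : Prop :=
  serre_condition 2 (stanley_reisner_ring k (independence_complex e)).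

(* Main.v *)
From HB Require Import structures.
Require Import Defs.
From mathcomp Require Import all_boot all_algebra.
From mathcomp Require Import ring_quotient boolp mpoly ring zify.

Set Implicit Arguments.
Unset Strict Implicit.
Unset Printing Implicit Defensive.

(* A Stanley-Reisner ring R = k[D] is S2 iff the link of every face of D that *)
(* contains an edge is connected.  If the vertices of the link of a face F    *)
(* split into two nonempty parts X, Y not joined by an edge, then in the      *)
(* localization at (x_v : v notin F) the maximal ideal is a sum of nonzero    *)
(* ideals (X) + (Y) with (X)(Y) = 0, which rules out regular sequences of     *)
(* length 2.  Conversely, let p be a prime and F the face of variables not in *)
(* p.  An element vanishes in R_p iff it vanishes on all facets containing F, *)
(* and elements given on these facets glue when they agree on intersections.  *)
(* If the link has an edge, the elementary symmetric polynomials e1, e2 in    *)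
(* the variables outside F are a regular sequence: they are coprime on each   *)
(* facet, and connectedness makes the quotients glue.  If the link consists   *)
(* of points, e2 is replaced by an element of p that is nonzero on F; if F is *)
(* a facet, unique factorization in k[x_v : v in F] yields a prime element of *)
(* p and an element of p which it does not divide.                            *)
(*                                                                            *)
(* For the graph, a disconnected link contains a path u - v - w with u, w not *)
(* adjacent, and all its other vertices are neighbours of v, or of both u and *)
(* w; in the components of the good cases this is a finite check.  Otherwise, *)
(* the vertices 0, a, -a, n of Z/2n induce a claw, isolated by a maximal      *)
(* independent set through 2a + n and -2a + n, unless 2n/t = 6, where the     *)
(* component is K_{3,3}.                                                      *)

Import GRing.Theory.
Local Open Scope ring_scope.
Local Open Scope quotient_scope.

(** Two independent halves meet in [serre2P], which replaces Serre's condition by connectedness of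
    the links that have an edge.

    Algebra: the Stanley-Reisner ideal is the intersection of the face primes, the kernels of
    [restr H] ([sr_idealP]). At a prime that misses exactly the variables of F, vanishing is tested
    on the facets above F and quotients computed facet by facet are glued ([loc_kerP],
    [glue_facets], [loc_depth2_facets]). [loc_serre2] builds regular sequences according to whether
    the link of F has an edge, has only isolated points, or has no vertex; for length 2 a chain of
    primes is exploited only in the last two cases. [disconnected_not_depth_ge2] gives the converse
    at the face prime of F.

    Graph: the link of a face is the independence complex of the graph induced on the vertices
    neither in the face nor adjacent to it, so it is disconnected when that graph is a join. Let M =
    2n/t, the order of a in Z/2n; M > 2 since a is neither 0 nor n. The components are prisms on 2M
    vertices for M odd and Moebius ladders on M vertices for M even. For M in {3,4,5,8} an
    enumeration excludes joins ([no_bits_bad_list], [circ_connected]). For M = 6 the component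
    K_{3,3} is itself a join ([circ_disconnected6]), and for the other M > 6 a claw can be isolated
    ([circ_disconnected_large]). *)

Definition divides (B : comNzRingType) (x y : B) : Prop := exists c, y = c * x.

(* This includes the units (and 0), so that a factorization into such         *)
(* elements needs no separate unit factor.                                    *)
Definition prime_like (B : comNzRingType) (x : B) : Prop :=
  forall y z, divides x (y * z) -> divides x y \/ divides x z.

Definition factorial_ring (B : comNzRingType) : Prop :=
  forall b : B, b != 0 ->
    exists2 s : seq B, {in s, forall x, prime_like x} & b = \prod_(x <- s) x.

(** * Divisibility and prime-like elements in a domain *)

Section Divisibility.
Variable B : idomainType.
Implicit Types x y z u : B.

Lemma divides_mulr x y z : divides x y -> divides x (y * z).
Proof. by case=> c ->; exists (c * z); ring. Qed.

Lemma divides_mull x y z : divides x z -> divides x (y * z).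
Proof. by case=> c ->; exists (y * c); ring. Qed.

Lemma divides_add x y z : divides x y -> divides x z -> divides x (y + z).
Proof. by move=> [c ->] [d ->]; exists (c + d); ring. Qed.

Lemma divides_sub x y z : divides x y -> divides x z -> divides x (y - z).
Proof. by move=> [c ->] [d ->]; exists (c - d); ring. Qed.

Lemma divides_sum x (I : Type) (r : seq I) (P : pred I) (F : I -> B) :
  (forall i, P i -> divides x (F i)) -> divides x (\sum_(i <- r | P i) F i).
Proof.
by move=> h; elim/big_ind: _ => // [|y z]; [exists 0; rewrite mul0r|exact: divides_add].
Qed.

Lemma prime_like_mul_unit u x :
  u \is a GRing.unit -> prime_like x -> prime_like (u * x).
Proof.
move=> hu px y z [c e]; have [|[d ->]|[d ->]] := px y z.
- by exists (c * u); rewrite e; ring.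
- by left; exists (d / u); rewrite mulrA divrK.
- by right; exists (d / u); rewrite mulrA divrK.
Qed.

(** The first factor [a] divides [x * y]. If it divides [y], it is cancelled. If [x = d * a],
    primality of [x] makes either [a] a unit, absorbed into [u], or [d] a unit, and then [a] is the
    factor that [x] cancels. The drop in length drives an induction in [factorial_poly]. *)
Lemma prime_like_cancel_prod x y u (s : seq B) :
  x != 0 -> x \isn't a GRing.unit -> u \is a GRing.unit ->
  {in s, forall z, prime_like z} -> {in s, forall z, z != 0} -> prime_like x ->
  x * y = u * \prod_(z <- s) z ->
  exists u' s', [/\ u' \is a GRing.unit, (size s' < size s)%N,
    {in s', forall z, prime_like z}, {in s', forall z, z != 0}
    & y = u' * \prod_(z <- s') z].
Proof.
move=> x0 xu; elim: s u y => [|a s IH] u y hu ps s0 px.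
  rewrite big_nil mulr1 => e.
  by move: hu; rewrite -e unitrM (negPf xu).
rewrite big_cons => e.
have [pa ps'] : prime_like a /\ {in s, forall z, prime_like z}.
  by split=> [|z zs]; apply: ps; rewrite inE ?eqxx ?zs ?orbT.
have [a0 s0'] : a != 0 /\ {in s, forall z, z != 0}.
  by split=> [|z zs]; apply: s0; rewrite inE ?eqxx ?zs ?orbT.
have [|[d xE]|[d yE]] := pa x y.
- by exists (u * \prod_(z <- s) z); rewrite e; ring.
- have [|[f dE]|[f aE]] := px d a.
  + by exists 1; rewrite xE mul1r.
  + have af1 : f * a = 1.
      by apply: (mulIf x0); rewrite mul1r [RHS]xE dE; ring.
    have ua : a \is a GRing.unit by apply/unitrP; exists f; rewrite af1 mulrC af1.
    have uua : u * a \is a GRing.unit by rewrite unitrM hu.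
    have [|u' [s' [hu' szs' ps1 s01 ->]]] := IH (u * a) y uua ps' s0' px.
      by rewrite e; ring.
    by exists u', s'; split=> //; apply: (leq_trans szs').
  + have df : f * d = 1.
      by apply: (mulIf x0); rewrite mul1r [RHS]xE aE; ring.
    have ud : d \is a GRing.unit by apply/unitrP; exists f; rewrite df mulrC df.
    exists (u / d), s; split=> //; first by rewrite unitrM hu unitrV.
    apply: (mulfI a0); apply: (mulfI (_ : d != 0)).
      by apply: contraTneq ud => ->; rewrite unitr0.
    by rewrite mulrA -xE e -[in LHS](divrK ud u); ring.
- have [|u' [s' [hu' szs' ps1 s01 y'E]]] := IH u d hu ps' s0' px.
    by apply: (mulfI a0); rewrite mulrCA [a * d]mulrC -yE e; ring.
  exists u', (a :: s'); split=> // [z|z|].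
  + by rewrite inE => /predU1P[->|/ps1].
  + by rewrite inE => /predU1P[->|/s01].
  + by rewrite big_cons yE y'E; ring.
Qed.

End Divisibility.

(** * Gauss's lemma and unique factorization in polynomial rings *)

Section GaussLemma.
Variable B : idomainType.
Implicit Types (c d x : B) (p q r : {poly B}).

Lemma divides_polyC x p : (forall i, divides x p`_i) -> divides x%:P p.
Proof.
move=> h; have [f fP] := choice h.
exists (\poly_(i < size p) f i); apply/polyP => i; rewrite coefMC coef_poly.
by case: ltnP => [_|/leq_sizeP->//]; rewrite ?mul0r.
Qed.

Lemma divides_polyC_coef x p i : divides x%:P p -> divides x p`_i.
Proof. by case=> q ->; exists q`_i; rewrite coefMC. Qed.

Lemma not_divides_polyC x p : ~ divides x%:P p ->
  exists2 i, ~ divides x p`_i & forall j, (j < i)%N -> divides x p`_j.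
Proof.
move=> np; have exi : exists i, `[< ~ divides x p`_i >].
  apply: contrapT => /forallNP h; apply: np; apply: divides_polyC => i.
  by apply: contrapT => /asboolP; apply: h.
have [i /asboolP hi imin] := ex_minnP exi.
exists i => // j ji; apply: contrapT => nj.
by have := imin j; rewrite leqNgt ji => /(_ (asboolT nj)).
Qed.

(** Let [i] and [j] be the first indices at which [x] fails to divide a coefficient of [p] and of
    [q]. Modulo [x], the coefficient of index [i + j] in the product is the product of these two. *)
Lemma prime_like_polyC x : prime_like x -> prime_like x%:P.
Proof.
move=> px p q pq; apply: contrapT => /not_orP[np nq].
have [i hi imin] := not_divides_polyC np.
have [j hj jmin] := not_divides_polyC nq.
suff: divides x (p`_i * q`_j) by case/px.
have := divides_polyC_coef (i + j)%N pq; rewrite coefM.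
have lti : (i < (i + j).+1)%N by rewrite ltnS leq_addr.
rewrite (bigD1 (Ordinal lti)) //= addKn => h.
pose rest := \sum_(l < (i + j).+1 | l != Ordinal lti) p`_l * q`_(i + j - l).
rewrite -[p`_i * _](addrK rest).
apply: divides_sub => //; apply: divides_sum => l nl.
have /= : (l : nat) != i by [].
rewrite neq_ltn => /orP[/imin|il]; first exact: divides_mulr.
by apply/divides_mull/jmin; rewrite ltn_subLR ?ltn_add2r // -ltnS.
Qed.

(** Clears denominators without a fraction field: each prime-like constant divides [q] or [r] and is
    cancelled there, so a factorization up to a constant becomes a genuine one. *)
Lemma scale_mul_cancel (s : seq B) p q r :
  {in s, forall x, prime_like x} -> {in s, forall x, x != 0} ->
  (\prod_(x <- s) x) *: p = q * r ->
  exists q' r' d e, [/\ p = q' * r', q = d *: q', r = e *: r', d != 0 & e != 0].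
Proof.
elim: s q r => [|x s IH] q r ps s0.
  by rewrite big_nil scale1r => ->; exists q, r, 1, 1; rewrite !scale1r oner_eq0.
rewrite big_cons -scalerA -mul_polyC => e.
have [px ps'] : prime_like x /\ {in s, forall z, prime_like z}.
  by split=> [|z zs]; apply: ps; rewrite inE ?eqxx ?zs ?orbT.
have [x0 s0'] : x != 0 /\ {in s, forall z, z != 0}.
  by split=> [|z zs]; apply: s0; rewrite inE ?eqxx ?zs ?orbT.
have xP0 : x%:P != 0 by rewrite polyC_eq0.
have [|[f qE]|[f rE]] := prime_like_polyC px (y := q) (z := r).
- by exists ((\prod_(j <- s) j) *: p); rewrite -e mulrC.
- have [|q' [r' [d [d' [-> fE -> d0 d'0]]]]] := IH f r ps' s0'.
    by apply: (mulfI xP0); rewrite e qE; ring.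
  exists q', r', (x * d), d'; rewrite mulf_neq0 //; split=> //.
  by rewrite qE fE -scalerA mulrC mul_polyC.
- have [|q' [r' [d [d' [-> -> fE d0 d'0]]]]] := IH q f ps' s0'.
    by apply: (mulfI xP0); rewrite e rE; ring.
  exists q', r', d, (x * d'); rewrite mulf_neq0 //; split=> //.
  by rewrite rE fE -scalerA mulrC mul_polyC.
Qed.

(** For primitive [r] all the constants cancel against [q]: a prime-like constant dividing [r] is a
    unit, so it divides [q] as well. *)
Lemma scale_mul_cancel_primitive (s : seq B) p q r :
  {in s, forall x, prime_like x} -> {in s, forall x, x != 0} ->
  (forall x, prime_like x -> divides x%:P r -> x \is a GRing.unit) ->
  (\prod_(x <- s) x) *: p = q * r -> divides r p.
Proof.
move=> + + hr; elim: s q => [|x s IH] q ps s0.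
  by rewrite big_nil scale1r => ->; exists q.
rewrite big_cons -scalerA -mul_polyC => e.
have [px ps'] : prime_like x /\ {in s, forall z, prime_like z}.
  by split=> [|z zs]; apply: ps; rewrite inE ?eqxx ?zs ?orbT.
have [x0 s0'] : x != 0 /\ {in s, forall z, z != 0}.
  by split=> [|z zs]; apply: s0; rewrite inE ?eqxx ?zs ?orbT.
have xP0 : x%:P != 0 by rewrite polyC_eq0.
have [f qE] : divides x%:P q.
  have [|//|/(hr x px) ux] := prime_like_polyC px (y := q) (z := r).
  - by exists ((\prod_(j <- s) j) *: p); rewrite -e mulrC.
  - by exists (q * (x^-1)%:P); rewrite -mulrA -polyCM mulVr // mulr1.
apply: (IH f) => //; apply: (mulfI xP0); rewrite e qE; ring.
Qed.

Lemma prod_seq_neq0 (s : seq B) : \prod_(x <- s) x != 0 ->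
  {in s, forall x, x != 0}.
Proof.
move=> h x xs; apply: contra_neq h => x0; apply/eqP.
by rewrite prodf_seq_eq0; apply/hasP; exists x; rewrite // x0 eqxx.
Qed.

(** Induction on the size of [p] and, within it, on the number of prime-like factors of the leading
    coefficient, which drops when a constant factor is split off. A primitive polynomial of positive
    degree with no proper factor over the fraction field is prime-like: the gcd argument works up to
    constants, and [scale_mul_cancel_primitive] removes them. *)
Lemma factorial_poly : factorial_ring B -> factorial_ring {poly B}.
Proof.
move=> ufdB p; have [m] := ubnP (size p); elim: m p => // m IHm p szp p0.
have lc0 : lead_coef p != 0 by rewrite lead_coef_eq0.
have [s0 ps0 lcE] := ufdB _ lc0.
have nzs0 : {in s0, forall x, x != 0} by apply: prod_seq_neq0; rewrite -lcE.
(* The unit [u] makes room for the one returned by [prime_like_cancel_prod]. *)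
have {lcE} : exists2 u, u \is a GRing.unit & lead_coef p = u * \prod_(x <- s0) x.
  by exists 1; rewrite ?unitr1 ?mul1r.
have [l] := ubnP (size s0).
elim: l p s0 szp p0 ps0 nzs0 {lc0} => // l IHl p s szp p0 ps nzs szs [u uu lcE].
have [[x [px nux xp]]|prim] :=
  pselect (exists x, [/\ prime_like x, x \isn't a GRing.unit & divides x%:P p]).
  case: xp => q pE.
  have x0 : x != 0 by apply: contra_neq p0 => x0; rewrite pE x0 polyC0 mulr0.
  have q0 : q != 0 by apply: contra_neq p0 => q0; rewrite pE q0 mul0r.
  have [|u' [s' [uu' szs' ps' nzs' lcqE]]] :=
      @prime_like_cancel_prod _ x (lead_coef q) u s x0 nux uu ps nzs px.
    by rewrite -lcE pE lead_coefM lead_coefC mulrC.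
  have szq : (size q < m.+1)%N.
    by apply: leq_trans szp; rewrite pE size_mul ?polyC_eq0 // size_polyC x0 addn1.
  have [|t pt qE] := IHl q s' szq q0 ps' nzs' (leq_trans szs' szs).
    by exists u'.
  exists (x%:P :: t); last by rewrite big_cons -qE mulrC.
  by move=> z; rewrite inE => /predU1P[->|/pt//]; apply: prime_like_polyC.
have {}prim x : prime_like x -> divides x%:P p -> x \is a GRing.unit.
  by move=> px xp; apply: contrapT => /negP nux; apply: prim; exists x.
have [sz1|sz1] := leqP (size p) 1.
  have [b pE] : exists b, p = b%:P by exists p`_0; apply: size1_polyC.
  have [|t pt bE] := ufdB b; first by rewrite -polyC_eq0 -pE.
  exists [seq x%:P | x <- t]; last by rewrite big_map -rmorph_prod -bE.
  by move=> z /mapP[x /pt px ->]; apply: prime_like_polyC.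
(* Here [%|] allows a nonzero constant multiplier, so [q] is a proper factor over the fraction
   field. *)
have [[q [qp szq]]|irr] := pselect (exists q, q %| p /\ (1 < size q < size p)%N).
  have /Pdiv.Idomain.dvdpP[[c r] /= c0 cE] := qp.
  have [t pt tE] := ufdB c c0.
  have nzt : {in t, forall x, x != 0} by apply: prod_seq_neq0; rewrite -tE.
  move: cE; rewrite tE => /(scale_mul_cancel pt nzt).
  case=> r' [q' [d [e [pE rE qE d0 e0]]]].
  have r'0 : r' != 0 by apply: contra_neq p0 => r'0; rewrite pE r'0 mul0r.
  have q'0 : q' != 0 by apply: contra_neq p0 => q'0; rewrite pE q'0 mulr0.
  have szq' : size q' = size q by rewrite qE size_scale.
  have szM : size p = (size r' + size q').-1 by rewrite pE size_mul.
  have szr' : (0 < size r')%N by rewrite size_poly_gt0.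
  have /andP[q_gt1 q_lt] := szq.
  have r'_lt : (size r' < m)%N.
    rewrite -szq' in q_gt1; clear -szM szp q_gt1.
    by move: (size p) (size r') (size q') szM szp q_gt1 => x y z; lia.
  have [s1 ps1 r'E] := IHm r' r'_lt r'0.
  have [|s2 ps2 q'E] := IHm q' _ q'0; first by rewrite szq' (leq_trans q_lt).
  exists (s1 ++ s2); last by rewrite big_cat -r'E -q'E.
  by move=> z; rewrite mem_cat => /orP[/ps1|/ps2].
exists [:: p]; last by rewrite big_seq1.
move=> z; rewrite inE => /eqP-> {z} g h [r ghE].
have pgh : p %| g * h by rewrite ghE dvdp_mulIr.
have lift f : p %| f -> divides p f.
  case/Pdiv.Idomain.dvdpP=> -[c q] /= c0 cE; have [t pt tE] := ufdB c c0.
  apply: (scale_mul_cancel_primitive pt _ prim); last by rewrite -tE; apply: cE.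
  by apply: prod_seq_neq0; rewrite -tE.
have [cop|ncop] := boolP (coprimep p g).
  by right; apply: lift; rewrite -(Gauss_dvdpr _ cop).
left; apply: lift; have gp := dvdp_gcdl p g.
have [szg|szg] := ltnP (size (gcdp p g)) (size p).
  case: irr; exists (gcdp p g); split=> //; rewrite szg andbT.
  rewrite ltn_neqAle eq_sym ncop size_poly_gt0 gcdp_eq0 negb_and p0 //.
apply: dvdp_trans (dvdp_gcdr p g).
have : gcdp p g %= p by rewrite -dvdp_size_eqp // eqn_leq szg dvdp_leq.
by case/andP.
Qed.

End GaussLemma.

(** * Unique factorization in k[x_1, ..., x_n] *)

Section FactorialMpoly.

Lemma factorial_iso (B C : comNzRingType) (f : {rmorphism B -> C})
    (g : {rmorphism C -> B}) : cancel f g -> cancel g f ->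
  factorial_ring C -> factorial_ring B.
Proof.
move=> fK gK ufdC b b0; have [|s ps fbE] := ufdC (f b).
  by apply: contra_neq b0 => fb0; rewrite -[b]fK fb0 rmorph0.
exists (map g s); last by rewrite -[b]fK fbE rmorph_prod big_map.
move=> _ /mapP[x /ps px ->] y z [c e].
have [|[d fE]|[d fE]] := px (f y) (f z).
- by exists (f c); rewrite -rmorphM e rmorphM gK.
- by left; exists (g d); rewrite -rmorphM -fE fK.
- by right; exists (g d); rewrite -rmorphM -fE fK.
Qed.

Variable k : fieldType.

(** The inverse of [muni]: multivariate polynomials are univariate ones in the last variable. *)
Definition mpoly_of_poly n (p : {poly {mpoly k[n]}}) : {mpoly k[n.+1]} :=
  horner_eval 'X_ord_max (map_poly (@mwiden n k) p).

HB.instance Definition _ n := GRing.RMorphism.copy (@mpoly_of_poly n)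
  (horner_eval ('X_ord_max : {mpoly k[n.+1]}) \o map_poly (@mwiden n k)).

Lemma muni_Xwiden n (i : 'I_n) :
  muni 'X_(widen_ord (leqnSn n) i) = ('X_i : {mpoly k[n]})%:P.
Proof.
rewrite muniE msuppX big_seq1 mcoeffX eqxx scale1r mnm1E -val_eqE /=.
rewrite ltn_eqF // expr0 alg_polyC; congr ('X_[_])%:P.
by apply/mnmP => j; rewrite mnmE !mnm1E -!val_eqE.
Qed.

Lemma muni_Xmax n : muni 'X_ord_max = 'X :> {poly {mpoly k[n]}}.
Proof.
rewrite muniE msuppX big_seq1 mcoeffX eqxx scale1r mnm1E eqxx expr1.
rewrite (_ : [multinom _ | _ < _] = 0%MM) ?mpolyX0 ?scale1r //.
apply/mnmP => j; rewrite mnmE mnm1E mnm0E -val_eqE /=.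
by rewrite gtn_eqF.
Qed.

Lemma mpoly_of_polyK n : cancel (@mpoly_of_poly n) (@muni n k).
Proof.
elim/poly_ind => [|p c IH]; first by rewrite !rmorph0.
rewrite !(rmorphD, rmorphM) /= IH; congr (_ * _ + _).
  by rewrite /mpoly_of_poly map_polyX /horner_eval hornerX muni_Xmax.
rewrite /mpoly_of_poly map_polyC /horner_eval hornerC /=.
elim/mpolyind: c => [|a m q _ _ IHq]; first by rewrite !rmorph0.
rewrite !rmorphD /= IHq; congr (_ + _).
rewrite -mul_mpolyC !rmorphM /= mwidenC muniC; congr (_ * _).
rewrite mpolyXE_id !rmorph_prod; apply: eq_bigr => i _.
by rewrite !rmorphXn /= mwidenX mnmwiden1 muni_Xwiden.
Qed.

Lemma muniK n : cancel (@muni n k) (@mpoly_of_poly n).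
Proof.
pose f := mpoly_of_poly (n := n) \o @muni n k.
have fX i : f 'X_i = 'X_i.
  case: (unliftP ord_max i) => [j ->|->]; rewrite /f /=.
    have -> : lift ord_max j = widen_ord (leqnSn n) j.
      by apply: val_inj; rewrite /= /bump leqNgt ltn_ord.
    rewrite muni_Xwiden /mpoly_of_poly map_polyC /horner_eval hornerC /=.
    by rewrite mwidenX mnmwiden1.
  by rewrite muni_Xmax /mpoly_of_poly map_polyX /horner_eval hornerX.
have fC a : f a%:MP = a%:MP.
  by rewrite /f /= muniC /mpoly_of_poly map_polyC /horner_eval hornerC /= mwidenC.
move=> p; rewrite -[LHS]/(f p) [p in LHS]mpolyE [RHS]mpolyE /f rmorph_sum.
apply: eq_bigr => m _; rewrite -mul_mpolyC rmorphM -[X in X * _]/(f _) fC.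
congr (_ * _); rewrite mpolyXE_id rmorph_prod; apply: eq_bigr => i _.
by rewrite rmorphXn -[X in X ^+ _]/(f _) fX.
Qed.

Lemma factorial_mpoly n : factorial_ring {mpoly k[n]}.
Proof.
elim: n => [|n IHn].
  move=> p p0; exists [:: p]; last by rewrite big_seq1.
  move=> q; rewrite inE => /eqP-> {q} y z _; left.
  have pE : p = (p@_0)%:MP.
    apply: msize1_polyC; rewrite msizeE; apply/bigmax_leqP_seq => m _ _.
    by rewrite mdegE big_ord0.
  exists (y * (p@_0)^-1%:MP); rewrite -mulrA {2}pE -mpolyCM mulVf ?mulr1 //.
  by apply: contra_neq p0 => p00; rewrite pE p00.
apply: (factorial_iso (@muniK n) (@mpoly_of_polyK n)).
exact: factorial_poly IHn.
Qed.

End FactorialMpoly.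

(** * Prime ideals as predicates *)

(** Unbundled, so that preimages, extensions and kernels of [restr] serve directly as primes;
    [prime_pred] bundles one where a [prime_idealr] is required. *)
Record is_prime (A : comNzRingType) (P : A -> Prop) : Prop := IsPrime {
  is_prime0 : P 0;
  is_primeD : forall x y, P x -> P y -> P (x + y);
  is_primeMl : forall x y, P y -> P (x * y);
  is_prime1 : ~ P 1;
  is_primeM : forall x y, P (x * y) -> P x \/ P y }.

Section PrimePredicates.
Variable A : comNzRingType.
Implicit Types P : A -> Prop.

Definition prime_pred P (hP : is_prime P) : A -> bool := fun x => `[< P x >].

Fact prime_pred_idealr P (hP : is_prime P) : idealr_closed (prime_pred hP).
Proof.
split; first exact/asboolP/(is_prime0 hP).
  by apply/asboolP; apply: (is_prime1 hP).
move=> a x y /asboolP Px /asboolP Py; apply/asboolP.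
by apply: (is_primeD hP) => //; apply: (is_primeMl hP).
Qed.

Fact prime_pred_prime P (hP : is_prime P) : prime_idealr_closed (prime_pred hP).
Proof.
move=> x y /asboolP /(is_primeM hP) h; apply/orP.
by case: h => h; [left|right]; apply/asboolP.
Qed.

HB.instance Definition _ P (hP : is_prime P) :=
  isIdealr.Build A (prime_pred hP) (prime_pred_idealr hP).
HB.instance Definition _ P (hP : is_prime P) :=
  isPrimeIdealrClosed.Build A (prime_pred hP) (@prime_pred_prime P hP).

Lemma is_primeMr P : is_prime P -> forall x y, P x -> P (x * y).
Proof. by move=> hP x y Px; rewrite mulrC; apply: is_primeMl. Qed.

Lemma is_primeB P : is_prime P -> forall x y, P x -> P y -> P (x - y).
Proof.
by move=> hP x y Px Py; rewrite -mulN1r; apply: is_primeD => //; apply: is_primeMl.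
Qed.

Lemma is_prime_sum P (I : Type) (r : seq I) (p : pred I) (F : I -> A) :
  is_prime P -> (forall i, p i -> P (F i)) -> P (\sum_(i <- r | p i) F i).
Proof.
move=> hP hF; elim/big_ind: _ => //; first exact: is_prime0 hP.
exact: is_primeD hP.
Qed.

Lemma is_prime_prod P (I : eqType) (r : seq I) (p : pred I) (F : I -> A) :
  is_prime P -> P (\prod_(i <- r | p i) F i) ->
  exists i, [/\ i \in r, p i & P (F i)].
Proof.
move=> hP; elim: r => [|x r IH]; first by rewrite big_nil => /(is_prime1 hP).
rewrite big_cons; case: ifP => [px|_ /IH[i [ir pi Pi]]]; last first.
  by exists i; rewrite inE ir orbT.
case/(is_primeM hP) => [Px|/IH[i [ir pi Pi]]].
  by exists x; rewrite inE eqxx.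
by exists i; rewrite inE ir orbT.
Qed.

Lemma prime_idealr_is_prime (p : prime_idealr A) :
  is_prime (fun x => x \in (p : {pred A})).
Proof.
split.
- exact: rpred0.
- by move=> x y; apply: rpredD.
- by move=> x y; apply: idealMr.
- by rewrite idealr1.
- by move=> x y; rewrite prime_idealrM => /orP.
Qed.

Lemma is_prime_preim (B : comNzRingType) (f : {rmorphism B -> A}) P :
  is_prime P -> is_prime (fun x => P (f x)).
Proof.
move=> hP; split.
- by rewrite rmorph0; apply: is_prime0 hP.
- by move=> x y; rewrite rmorphD; apply: is_primeD hP _ _.
- by move=> x y; rewrite rmorphM; apply: is_primeMl.
- by rewrite rmorph1; apply: is_prime1 hP.
- by move=> x y; rewrite rmorphM; apply: is_primeM.
Qed.

End PrimePredicates.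

(* [B] is a ring of fractions of [f @` A] with respect to the prime [Q]; the  *)
(* kernel of [f] is left unspecified.                                         *)
Record is_localization (A B : comNzRingType) (f : {rmorphism A -> B})
    (Q : A -> Prop) : Prop := IsLocalization {
  loc_prime : is_prime Q;
  loc_frac : forall x, exists a s, ~ Q s /\ f s * x = f a;
  loc_unit : forall s, ~ Q s -> invertible (f s);
  loc_nonunit : forall a, Q a -> ~ invertible (f a) }.

(** * The canonical map to the localization *)

Section LocalizationMap.
Import Localization.
Variables (R : comNzRingType) (p : prime_idealr R).

Definition loc (a : R) : localization p :=
  \pi_(localization p) (mkfrac a (notin1 p)).

Fact loc_zmod : zmod_morphism loc.
Proof.
move=> a b; rewrite /loc -[RHS]/(add _ (opp _)) !piE.
by apply: eq_local; rewrite /= !denE /den /=; ring.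
Qed.

Fact loc_monoid : monoid_morphism loc.
Proof.
split=> [|a b]; first by rewrite -[RHS]/(one p) !piE.
rewrite /loc -[RHS]/(mul _ _) !piE.
by apply: eq_local; rewrite /= !denE /den /=; ring.
Qed.

HB.instance Definition _ :=
  GRing.isZmodMorphism.Build R (localization p) loc loc_zmod.
HB.instance Definition _ :=
  GRing.isMonoidMorphism.Build R (localization p) loc loc_monoid.

Lemma loc_eq0 a : loc a = 0 <-> exists2 u, u \notin (p : {pred R}) & u * a = 0.
Proof.
rewrite /loc -[0]/(zero p) !piE; split.
  move/eqmodP/asboolP => -[u hu]; rewrite /= !denE /den /= mulr1 mul0r mulr0.
  by exists u.
case=> u hu e; apply/eqmodP/asboolP; exists u => //=.
by rewrite !denE /den /= mulr1 mul0r mulr0.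
Qed.

Lemma loc_is_localization : is_localization loc (fun x => x \in (p : {pred R})).
Proof.
have unit s : s \notin (p : {pred R}) -> invertible (loc s).
  move=> hs; exists (\pi_(localization p) (mkfrac 1 hs)).
  rewrite /loc -[LHS]/(mul _ _) -[RHS]/(one p) !piE.
  by apply: eq_local; rewrite /= !denE /den /=; ring.
split.
- exact: prime_idealr_is_prime.
- move=> x; rewrite -[x]reprK; case: (repr x) => a [s hs]; exists a, s.
  split; first exact/negP.
  rewrite /loc -[LHS]/(mul _ _) !piE.
  by apply: eq_local; rewrite /= !denE /den /=; ring.
- by move=> s /negP; apply: unit.
- move=> a pa [x]; rewrite -[x]reprK; case: (repr x) => b [s hs].
  rewrite /loc -[LHS]/(mul _ _) -[RHS]/(one p) !piE.
  move/eqmodP/asboolP => -[u hu]; rewrite /= !denE /den /=.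
  move=> e; have : u * s \in (p : {pred R}).
    have -> : u * s = u * (1 * (1 * s)) by ring.
    by rewrite -e mulr1 idealMr // mulrC idealMr.
  by rewrite prime_idealrM (negPf hu) (negPf hs).
Qed.

End LocalizationMap.

(** * Chains of primes and regular sequences in a ring of fractions *)

Section Localized.
Variables (A B : comNzRingType) (f : {rmorphism A -> B}) (Q : A -> Prop).
Hypothesis locf : is_localization f Q.
Let hQ := loc_prime locf.

(** Presents the localization of a Stanley-Reisner ring as a ring of fractions of an image of the
    polynomial ring, so that later computations use polynomials. *)
Lemma loc_comp (C : comNzRingType) (g : {rmorphism C -> A}) :
  (forall a, exists c, g c = a) ->
  is_localization (f \o g : {rmorphism C -> B}) (fun c => Q (g c)).
Proof.
move=> gsurj; split.
- exact: is_prime_preim.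
- move=> x; have [a [s [Qs e]]] := loc_frac locf x.
  have [c cE] := gsurj a; have [d dE] := gsurj s.
  by exists c, d; rewrite /= cE dE.
- by move=> s /(loc_unit locf).
- by move=> a /(loc_nonunit locf).
Qed.

Lemma loc_cancel s x y : ~ Q s -> f s * x = f s * y -> x = y.
Proof.
move=> /(loc_unit locf)[t st] /(congr1 (fun z => t * z)).
by rewrite /= !mulrA [t * _]mulrC st !mul1r.
Qed.

Lemma is_prime_invertible (P : B -> Prop) x : is_prime P -> invertible x -> ~ P x.
Proof.
by move=> hP [y xy] Px; apply: (is_prime1 hP); rewrite -xy; apply: is_primeMr.
Qed.

Lemma loc_prime_sub (P : B -> Prop) a : is_prime P -> P (f a) -> Q a.
Proof.
move=> hP Pa; apply: contrapT => /(loc_unit locf) ua.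
exact: is_prime_invertible hP ua Pa.
Qed.

(** Contraction of a chain. A fraction witnessing strictness has a numerator that witnesses it too,
    since denominators are units. *)
Lemma loc_krull_dim_ge n : krull_dim_ge B n ->
  exists P : 'I_n.+1 -> A -> Prop, [/\ forall i, is_prime (P i),
    forall i a, f a = 0 -> P i a, forall i a, P i a -> Q a
    & forall i j : 'I_n.+1, (i < j)%N ->
      (forall a, P i a -> P j a) /\ exists a, P j a /\ ~ P i a].
Proof.
case=> P hP; have pP i := prime_idealr_is_prime (P i).
exists (fun i a => f a \in (P i : {pred B})); split.
- by move=> i; apply: (is_prime_preim f (pP i)).
- by move=> i a ->; apply: is_prime0 (pP i).
- by move=> i a; apply: loc_prime_sub (pP i).
move=> i j ij; have [sij nsji] := hP i j ij; split=> [a|]; first exact: sij.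
apply: contrapT => h; apply: nsji => x Pjx.
have [a [s [Qs e]]] := loc_frac locf x.
have Pja : f a \in (P j : {pred B}) by rewrite -e idealMr.
have : f a \in (P i : {pred B}).
  by apply: contrapT => nPia; apply: h; exists a.
rewrite -e prime_idealrM => /orP[|//] Ps.
by case: (is_prime_invertible (pP i) (loc_unit locf Qs)).
Qed.

(** The extension of [P]; for a prime between the kernel of [f] and [Q], its contraction is [P]
    again ([loc_extE]). *)
Definition loc_ext (P : A -> Prop) (x : B) : Prop :=
  exists a s, [/\ ~ Q s, P a & f s * x = f a].

Lemma loc_extE (P : A -> Prop) a : is_prime P -> (forall a, P a -> Q a) ->
  (forall a, f a = 0 -> P a) -> loc_ext P (f a) <-> P a.
Proof.
move=> hP PQ KP; split=> [[b [s [Qs Pb]]]|Pa]; last first.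
  by exists a, 1; rewrite rmorph1 mul1r; split=> // /(is_prime1 hQ).
rewrite -rmorphM => e; have /(is_primeM hP)[/PQ //|//] : P (s * a).
rewrite -(subrK b (s * a)); apply: (is_primeD hP) => //; apply: KP.
by rewrite rmorphB e subrr.
Qed.

Lemma loc_ext_prime (P : A -> Prop) : is_prime P -> (forall a, P a -> Q a) ->
  (forall a, f a = 0 -> P a) -> is_prime (loc_ext P).
Proof.
move=> hP PQ KP; have nQM s t : ~ Q s -> ~ Q t -> ~ Q (s * t).
  by move=> Qs Qt /(is_primeM hQ)[].
split.
- by rewrite -(rmorph0 f); apply/loc_extE => //; apply: is_prime0 hP.
- move=> x y [a [s [Qs Pa ea]]] [b [t [Qt Pb eb]]].
  exists (t * a + s * b), (s * t); split; first exact: nQM.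
    by apply: (is_primeD hP); apply: (is_primeMl hP).
  by rewrite !(rmorphD, rmorphM) /= -ea -eb; ring.
- move=> x y [a [s [Qs Pa ea]]]; have [b [t [Qt eb]]] := loc_frac locf x.
  exists (b * a), (t * s); split; [exact: nQM|exact: (is_primeMl hP)|].
  by rewrite !rmorphM /= -ea -eb; ring.
- by rewrite -(rmorph1 f) => /loc_extE h; apply: (is_prime1 hP); apply: h.
- move=> x y [c [u [Qu Pc ec]]]; have [a [s [Qs ea]]] := loc_frac locf x.
  have [b [t [Qt eb]]] := loc_frac locf y.
  have : loc_ext P (f (u * a * b)).
    exists (s * t * c), 1; split; first exact: is_prime1 hQ.
      exact: (is_primeMl hP).
    by rewrite !rmorphM /= -ea -eb -ec rmorph1; ring.
  move/(loc_extE _ hP PQ KP)/(is_primeM hP) => [/(is_primeM hP)[/PQ //|Pa]|Pb].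
    by left; exists a, s.
  by right; exists b, t.
Qed.

Lemma loc_krull_dim_ge_intro n (P : 'I_n.+1 -> A -> Prop) :
  (forall i, is_prime (P i)) -> (forall i a, f a = 0 -> P i a) ->
  (forall i a, P i a -> Q a) ->
  (forall i j : 'I_n.+1, (i < j)%N ->
      (forall a, P i a -> P j a) /\ exists a, P j a /\ ~ P i a) ->
  krull_dim_ge B n.
Proof.
move=> hP KP PQ sP.
exists (fun i => prime_pred (loc_ext_prime (hP i) (PQ i) (KP i)) : prime_idealr B).
move=> i j ij; have [sij [b [Pjb nPib]]] := sP i j ij; split.
  move=> x /asboolP[a [s [Qs Pa e]]]; apply/asboolP.
  by exists a, s; split=> //; apply: sij.
move=> h; apply: nPib; apply/(loc_extE _ (hP i) (PQ i) (KP i))/asboolP.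
by apply: h; apply/asboolP/(loc_extE _ (hP j) (PQ j) (KP j)).
Qed.

Lemma in_generated_nil (z : B) : in_generated [::] z <-> z = 0.
Proof.
split=> [[c ->]|->]; first by rewrite big_ord0.
by exists (fun=> 0); rewrite big_ord0.
Qed.

Lemma in_generated_seq1 (x z : B) : in_generated [:: x] z <-> exists c, z = c * x.
Proof.
split=> [[c ->]|[c ->]]; first by exists (c ord0); rewrite big_ord1.
by exists (fun=> c); rewrite big_ord1.
Qed.

Lemma loc_depth_ge0 : depth_ge B 0.
Proof.
exists [::]; split=> //; split=> // /in_generated_nil /eqP.
by rewrite oner_eq0.
Qed.

Lemma loc_proper (s : seq A) : {in s, forall a, Q a} ->
  ~ in_generated (map f s) 1.
Proof.
(* The generated ideal lies in the extension of [Q], which is prime and hence proper. *)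
move=> hs [c e]; pose P := loc_ext Q.
have hP : is_prime P.
  apply: loc_ext_prime => // a fa0; apply: contrapT => /(loc_unit locf)[y].
  by rewrite fa0 mul0r => /eqP; rewrite eq_sym oner_eq0.
apply: (is_prime1 hP); rewrite e; apply: is_prime_sum => // i _.
apply: (is_primeMl hP); have ilt : (i < size s)%N by rewrite -(size_map f).
rewrite (nth_map 0) //; exists s`_i, 1; rewrite rmorph1 mul1r.
by split=> //; [apply: is_prime1 hQ|apply: hs; apply: mem_nth].
Qed.

Lemma loc_regular1 a : (forall z, f (a * z) = 0 -> f z = 0) ->
  forall z, f a * z = 0 -> z = 0.
Proof.
move=> ha z; have [b [s [Qs e]]] := loc_frac locf z => az.
apply: (loc_cancel Qs); rewrite e mulr0; apply: ha.
by rewrite rmorphM -e mulrCA az mulr0.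
Qed.

Lemma loc_depth_ge1 a : Q a -> (forall z, f (a * z) = 0 -> f z = 0) ->
  depth_ge B 1.
Proof.
move=> Qa ha; exists [:: f a]; split=> //.
  by move=> x; rewrite inE => /eqP->; apply: (loc_nonunit locf).
split; last first.
  by apply: (@loc_proper [:: a]) => x; rewrite inE => /eqP->.
move=> [|//] z _ /= /in_generated_nil az; apply/in_generated_nil.
exact: (loc_regular1 ha).
Qed.

(** Clearing denominators reduces regularity to equations between images of elements of [A]. *)
Lemma loc_depth_ge2 a b : Q a -> Q b -> (forall z, f (a * z) = 0 -> f z = 0) ->
  (forall z y, f (b * z) = f (a * y) -> exists w, f z = f (a * w)) ->
  depth_ge B 2.
Proof.
move=> Qa Qb ha hb; exists [:: f a; f b]; split=> //.
  by move=> x; rewrite !inE => /orP[]/eqP->; apply: (loc_nonunit locf).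
split; last first.
  by apply: (@loc_proper [:: a; b]) => x; rewrite !inE => /orP[]/eqP->.
move=> [|[|//]] z _ /=.
  by move=> /in_generated_nil az; apply/in_generated_nil; apply: (loc_regular1 ha).
move=> /in_generated_seq1[y e]; apply/in_generated_seq1.
have [c [s [Qs ec]]] := loc_frac locf z; have [d [t [Qt ed]]] := loc_frac locf y.
have [w ew] : exists w, f (t * c) = f (a * w).
  apply: (hb _ (s * d)); rewrite !rmorphM -ec -ed.
  have -> : f b * (f t * (f s * z)) = f t * f s * (f b * z) by ring.
  by rewrite e; ring.
have [v sv] : invertible (f (t * s)).
  by apply: (loc_unit locf) => /(is_primeM hQ)[].
exists (f w * v).
rewrite -[LHS]mul1r -sv rmorphM.
have -> : f t * f s * v * z = f t * (f s * z) * v by ring.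
by rewrite ec -rmorphM ew rmorphM; ring.
Qed.

Lemma depth_ge2P : depth_ge B 2 -> exists x y : B,
  [/\ ~ invertible x, ~ invertible y, forall z, x * z = 0 -> z = 0
    & forall z w, y * z = w * x -> exists v, z = v * x].
Proof.
case=> [[|x [|y [|? ?]]]] [] // _ nu [reg _]; exists x, y; split.
- by apply: nu; rewrite inE eqxx.
- by apply: nu; rewrite !inE eqxx orbT.
- by move=> z xz; apply/in_generated_nil; apply: (reg 0%N) => //; apply/in_generated_nil.
- move=> z w e; apply/in_generated_seq1; apply: (reg 1%N) => //.
  by apply/in_generated_seq1; exists w.
Qed.

End Localized.

(** * Face restrictions, the Stanley-Reisner ideal and gluing over facets *)

Section Restriction.
Variables (k : fieldType) (N : nat).
Local Notation A := {mpoly k[N]}.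
Implicit Types (p q : A) (m : 'X_{1..N}) (F G H : {set 'I_N}).
Implicit Types D : simplicial_complex 'I_N.

Definition mnm_supp m : {set 'I_N} := [set i | m i != 0%N].

(* The quotient map k[x_v] -> k[x_v : v \in H] killing the other variables,   *)
(* seen as an endomorphism of the polynomial ring.                            *)
Definition restr H p : A :=
  p \mPo [tuple if i \in H then 'X_i else 0 | i < N].

HB.instance Definition _ H := GRing.RMorphism.copy (restr H)
  (comp_mpoly [tuple if i \in H then 'X_i else 0 : A | i < N]).

Lemma restrC H c : restr H c%:MP = c%:MP.
Proof. exact: comp_mpolyC. Qed.

Lemma restrX H i : restr H 'X_i = if i \in H then 'X_i else 0.
Proof. by rewrite /restr comp_mpolyXU -tnth_nth tnth_mktuple. Qed.

Lemma restr_mnm H m : restr H 'X_[m] = if mnm_supp m \subset H then 'X_[m] else 0.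
Proof.
rewrite [in LHS]mpolyXE_id rmorph_prod; case: ifPn => [sub|/subsetPn[i]].
  rewrite mpolyXE_id; apply: eq_bigr => i _; rewrite rmorphXn /= restrX.
  case: ifP => // niH; have [->|mi0] := eqVneq (m i) 0%N; first by rewrite !expr0.
  by move/subsetP/(_ i): sub; rewrite inE mi0 niH => /(_ isT).
rewrite inE => mi0 niH; rewrite (bigD1 i) //= rmorphXn /= restrX (negPf niH).
by rewrite expr0n (negPf mi0) mul0r.
Qed.

Lemma mcoeff_restr H p m :
  (restr H p)@_m = if mnm_supp m \subset H then p@_m else 0.
Proof.
rewrite [p in LHS]mpolyE [p in RHS]mpolyE !rmorph_sum !raddf_sum /=.
have -> (b : bool) (r : seq 'X_{1..N}) (F : 'X_{1..N} -> k) :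
    (if b then \sum_(i <- r) F i else 0) = \sum_(i <- r) if b then F i else 0.
  by case: b => //; rewrite big1.
apply: eq_bigr => m' _; rewrite -mul_mpolyC rmorphM /= restrC restr_mnm.
rewrite !mul_mpolyC !mcoeffZ mcoeffX [m' == m]eq_sym.
case: (eqVneq m m') => [->|ne]; last first.
  case: ifP; case: ifP; rewrite ?mcoeffX ?[m' == m]eq_sym ?(negPf ne) //=;
  by rewrite ?mcoeff0 ?mulr0.
by case: ifP; rewrite ?mcoeffX ?eqxx ?mcoeff0 ?mulr0.
Qed.

Lemma restr_restr G H p : restr G (restr H p) = restr (G :&: H) p.
Proof.
apply/mpolyP => m; rewrite !mcoeff_restr subsetI.
by case: (_ \subset G); case: (_ \subset H).
Qed.

Lemma restr_sub G H p : G \subset H -> restr G (restr H p) = restr G p.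
Proof. by move=> /setIidPl sub; rewrite restr_restr sub. Qed.

Lemma msize_restr H p : (msize (restr H p) <= msize p)%N.
Proof.
rewrite [leqLHS]msizeE; apply/bigmax_leqP_seq => m + _.
rewrite mcoeff_msupp mcoeff_restr; case: ifP => [_|]; last by rewrite eqxx.
by rewrite -mcoeff_msupp; apply: msize_mdeg_lt.
Qed.

(** Membership test for monomial ideals: each monomial of [p] is assigned to one chosen generator
    dividing it. *)
Lemma mpoly_cover (I : finType) (P : pred I) (E : I -> 'X_{1..N}) p :
  (forall m, m \in msupp p -> exists2 i, P i & (E i <= m)%MM) ->
  exists c : I -> A, p = \sum_(i | P i) c i * 'X_[E i].
Proof.
move=> h; pose sel m := [pick i | P i && (E i <= m)%MM].
exists (fun i => \sum_(m <- msupp p | sel m == Some i) p@_m *: 'X_[m - E i]).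
under eq_bigr do rewrite mulr_suml.
rewrite (exchange_big_dep xpredT) //= [LHS]mpolyE big_seq [RHS]big_seq.
apply: eq_bigr => m mp; rewrite /sel; case: pickP => [i /andP[Pi Em]|none]; last first.
  by have [i Pi Em] := h m mp; have := none i; rewrite Pi Em.
rewrite (big_pred1 i) => [|j]; last first.
  rewrite /= andbC; case: eqP => [[<-]|ne]; rewrite ?Pi ?eqxx //=.
  by apply/esym/eqP => e; apply: ne; rewrite e.
by rewrite -scalerAl -mpolyXD submK.
Qed.

Lemma restr_eq0 F p : restr F p = 0 ->
  exists c : 'I_N -> A, p = \sum_(v | v \notin F) c v * 'X_v.
Proof.
move=> p0; apply: mpoly_cover => m mp.
have /subsetPn[v vm vF] : ~~ (mnm_supp m \subset F).
  apply: contraL mp => sub; rewrite -mcoeff_eq0.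
  by move/(congr1 (mcoeff m)): p0; rewrite mcoeff_restr sub mcoeff0 => ->.
by exists v => //; rewrite lep1mP; rewrite inE in vm.
Qed.

Lemma restr_eq0_divides v p : restr [set~ v] p = 0 -> divides 'X_v p.
Proof.
case/restr_eq0 => c ->; exists (c v); apply: (big_pred1 v) => i.
by rewrite !inE negbK.
Qed.

Lemma restr_prime H : is_prime (fun p => restr H p = 0).
Proof.
split.
- exact: rmorph0.
- by move=> p q pH qH; rewrite rmorphD /= pH qH addr0.
- by move=> p q qH; rewrite rmorphM /= qH mulr0.
- by rewrite rmorph1 => /eqP; rewrite oner_eq0.
- move=> p q /eqP; rewrite rmorphM mulf_eq0 => /orP[]/eqP; by [left|right].
Qed.

Lemma is_prime_restr (Q : A -> Prop) F p : is_prime Q ->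
  (forall v, v \notin F -> Q 'X_v) -> Q (p - restr F p).
Proof.
move=> hQ QX; have [|c ->] := @restr_eq0 F (p - restr F p).
  by rewrite rmorphB /= restr_restr setIid subrr.
by apply: is_prime_sum => // v vF; apply: (is_primeMl hQ); apply: QX.
Qed.

Lemma is_prime_restrP (Q : A -> Prop) F p : is_prime Q ->
  (forall v, v \notin F -> Q 'X_v) -> Q (restr F p) <-> Q p.
Proof.
move=> hQ QX; split=> Qp.
  by rewrite -(subrK (restr F p) p); apply: (is_primeD hQ) => //; apply: is_prime_restr.
by rewrite -(subKr p (restr F p)); apply: (is_primeB hQ) => //; apply: is_prime_restr.
Qed.

Lemma mnm_supp_set F : mnm_supp (\sum_(v in F) U_(v))%MM = F.
Proof.
apply/setP => i; rewrite inE mnm_sumE.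
under eq_bigr do rewrite mnm1E.
case: (boolP (i \in F)) => iF; first by rewrite (bigD1 i) //= eqxx.
by rewrite big1 // => v vF; case: eqP => // vi; rewrite -vi vF in iF.
Qed.

Lemma face_monomialE F : face_monomial k F = 'X_[\sum_(v in F) U_(v)].
Proof. exact: mprodXE. Qed.

Lemma restr_face_monomial H F :
  restr H (face_monomial k F) = if F \subset H then face_monomial k F else 0.
Proof. by rewrite face_monomialE restr_mnm mnm_supp_set. Qed.

(** Both sides say that every monomial of [p] is supported on a non-face. *)
Lemma sr_idealP D p : sr_ideal D p <-> forall H, H \in D -> restr H p = 0.
Proof.
split=> [/asboolP[c ->] H HD|p0].
  rewrite rmorph_sum big1 // => F FD; rewrite rmorphM /= restr_face_monomial.
  by rewrite ifN ?mulr0 //; apply: contra FD => sub; apply: facesS sub HD.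
apply/asboolP; have [|c cE] :=
    @mpoly_cover {set 'I_N} (fun F => F \notin D) (fun F => \sum_(v in F) U_(v))%MM p.
  move=> m mp; exists (mnm_supp m).
    apply: contraL mp => mD; rewrite -mcoeff_eq0.
    by move/(congr1 (mcoeff m)): (p0 _ mD); rewrite mcoeff_restr subxx mcoeff0 => ->.
  apply/mnm_lepP => i; rewrite mnm_sumE; under eq_bigr do rewrite mnm1E.
  case: (boolP (i \in mnm_supp m)) => im.
    rewrite (bigD1 i) //= eqxx big1 ?addn0 => [|j /andP[_ /negPf->]] //.
    by rewrite inE -lt0n in im.
  by rewrite big1 // => v vF; case: eqP => // vi; rewrite -vi vF in im.
by exists c; rewrite {1}cE; apply: eq_bigr => F _; rewrite face_monomialE.
Qed.

Definition star D F : {set {set 'I_N}} := [set H in faces D | F \subset H].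

Definition facet_above D F H := (H \in star D F) /\
  forall H', H' \in star D F -> H \subset H' -> H' = H.

Lemma facet_above_exists D F G : G \in star D F ->
  exists2 H, facet_above D F H & G \subset H.
Proof.
case/(maxset_exists (P := fun H => H \in star D F)) => H /maxsetP[HD Hmax] GH.
by exists H => //; split.
Qed.

(** Each coefficient of [W] is read from one facet containing the support of the monomial; agreement
    on intersections makes the choice of facet immaterial. *)
Lemma glue_facets D F (w : {set 'I_N} -> A) :
  (forall H H', facet_above D F H -> facet_above D F H' ->
     restr (H :&: H') (w H) = restr (H :&: H') (w H')) ->
  exists W, forall H, facet_above D F H -> restr H W = restr H (w H).
Proof.
move=> wP.
have /choice[c cP] (G : {set 'I_N}) : exists H, G \in star D F ->
    facet_above D F H /\ G \subset H.
  have [/facet_above_exists[H HF GH]|] := boolP (G \in star D F); first by exists H.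
  by exists set0.
(* A support [G] with [G :|: F] not a face lies in no facet above [F], whence the default 0. *)
pose u G := if G :|: F \in D then w (c (G :|: F)) else 0.
pose W := \sum_G \sum_(m <- msupp (u G) | mnm_supp m == G) (u G)@_m *: 'X_[m].
have WE m : W@_m = (u (mnm_supp m))@_m.
  rewrite raddf_sum (bigD1 (mnm_supp m)) //= [X in _ + X]big1 ?addr0 => [|G ne].
    rewrite raddf_sum /=; under eq_bigr do rewrite mcoeffZ mcoeffX.
    have [mw|mw] := boolP (m \in msupp (u (mnm_supp m))).
      rewrite big_mkcond (bigD1_seq m) ?msupp_uniq //= !eqxx mulr1.
      by rewrite big1 ?addr0 // => m' /negPf->; rewrite mulr0 if_same.
    rewrite [RHS]memN_msupp_eq0 // big_seq_cond big1 // => m' /andP[mu _].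
    by case: eqP => [e|]; rewrite ?mulr0 //; move: mu; rewrite e (negPf mw).
  rewrite raddf_sum big1 //= => m' /eqP m'G; rewrite mcoeffZ mcoeffX.
  case: eqP => [e|_]; last by rewrite mulr0.
  by rewrite -e m'G eqxx in ne.
exists W => H HF; apply/mpolyP => m; rewrite !mcoeff_restr WE.
case: ifP => // mH; have [[+ _] _] := (HF, tt); rewrite inE => /andP[HD FH].
have sD : mnm_supp m :|: F \in D by apply: facesS HD; rewrite subUset mH.
rewrite /u sD; have [|cF sc] := cP (mnm_supp m :|: F); first by rewrite inE sD subsetUr.
have := congr1 (mcoeff m) (wP _ _ HF cF); rewrite !mcoeff_restr subsetI mH.
by rewrite (subset_trans (subsetUl _ _) sc) /= => ->.
Qed.

End Restriction.

(** * Coprimality of the first two elementary symmetric polynomials *)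

Section ElementaryPair.
Variables (k : fieldType) (N : nat).
Local Notation A := {mpoly k[N]}.
Implicit Types (p q h z : A) (S F H : {set 'I_N}).

Definition esum1 S : A := \sum_(v in S) 'X_v.
Definition esum2 S : A := \sum_(v in S) \sum_(w in S | (v < w)%N) 'X_v * 'X_w.

Lemma restr_esum1 H S : restr H (esum1 S) = esum1 (S :&: H).
Proof.
rewrite /esum1 rmorph_sum /= big_mkcond [RHS]big_mkcond; apply: eq_bigr => v _.
by rewrite restrX !inE; case: (v \in S); case: (v \in H).
Qed.

Lemma restr_esum2 H S : restr H (esum2 S) = esum2 (S :&: H).
Proof.
rewrite /esum2 rmorph_sum /= big_mkcond [RHS]big_mkcond; apply: eq_bigr => v _.
rewrite !inE; case: (v \in S) => //=; rewrite rmorph_sum /=; case: ifP => vH.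
  rewrite big_mkcond [RHS]big_mkcond; apply: eq_bigr => w _.
  rewrite rmorphM /= !restrX vH !inE.
  by case: (w \in S); case: (w \in H); case: (v < w)%N; rewrite //= mulr0.
by rewrite big1 // => w _; rewrite rmorphM /= restrX vH mul0r.
Qed.

Lemma esum1_neq0 S v : v \in S -> esum1 S != 0.
Proof.
move=> vS; apply/eqP => /(congr1 (mcoeff U_(v))); rewrite mcoeff0 raddf_sum /=.
rewrite (bigD1 v) //= mcoeffXU eqxx big1 ?addr0 => [/eqP|w /andP[_ wv]].
  by rewrite oner_eq0.
by rewrite mcoeffXU (negPf wv).
Qed.

Lemma mpoly_ring_ind (P : A -> Prop) :
  (forall c, P c%:MP) -> (forall i, P 'X_i) ->
  (forall p q, P p -> P q -> P (p + q)) ->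
  (forall p q, P p -> P q -> P (p * q)) -> forall p, P p.
Proof.
move=> PC PX PD PM p; rewrite [p]mpolyE; apply: (big_ind P).
- by rewrite -mpolyC0; apply: (PC).
- exact: PD.
move=> m _; rewrite -mul_mpolyC; apply: (PM _ _ (PC _)).
rewrite mpolyXE_id; apply: (big_ind P).
- by rewrite -mpolyC1; apply: PC.
- exact: PM.
move=> i _; elim: (m i) => [|n IHn]; first by rewrite expr0 -mpolyC1; apply: PC.
by rewrite exprS; apply: PM.
Qed.

Lemma divides_comp_mpoly h (t : N.-tuple A) p :
  (forall i, divides h ('X_i - tnth t i)) -> divides h (p - (p \mPo t)).
Proof.
move=> ht; elim/mpoly_ring_ind: p => [c|i|p q IHp IHq|p q IHp IHq].
- by rewrite comp_mpolyC subrr; exists 0; rewrite mul0r.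
- by rewrite comp_mpolyXU -tnth_nth.
- by rewrite comp_mpolyD opprD addrACA; apply: (divides_add IHp IHq).
- rewrite rmorphM /=; set p' := p \mPo t in IHp *; set q' := q \mPo t in IHq *.
  have -> : p * q - p' * q' = q * (p - p') + p' * (q - q').
    by move: p' q' {IHp IHq} => p' q'; ring.
  exact: (divides_add (divides_mull q IHp) (divides_mull p' IHq)).
Qed.

(** The substitution [t] changes a polynomial by a multiple of e1 and kills e1, so modulo e1 one
    computes in a domain. It remains to see that e1 does not divide e2. *)
Lemma esum12_coprime S v0 v1 z : v0 \in S -> v1 \in S -> (v0 < v1)%N ->
  divides (esum1 S) (esum2 S * z) -> divides (esum1 S) z.
Proof.
move=> v0S v1S lt01; set h := esum1 S; have v10 : v1 != v0 by rewrite -val_eqE gtn_eqF.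
pose t := [tuple 'X_i - (if i == v0 then h else 0) | i < N].
have tE i : tnth t i = 'X_i - (if i == v0 then h else 0) by rewrite tnth_mktuple.
have divt p : divides h (p - (p \mPo t)).
  apply: divides_comp_mpoly => i; rewrite tE opprB addrC subrK.
  by case: ifP => _; [exists 1; rewrite mul1r|exists 0; rewrite mul0r].
have ht0 : h \mPo t = 0.
  rewrite {1}/h rmorph_sum /=.
  under eq_bigr do rewrite comp_mpolyXU -tnth_nth tE.
  rewrite sumrB -big_mkcondr /= [X in _ - X](big_pred1 v0) => [|i].
    by rewrite -/(esum1 S) subrr.
  by rewrite /= andbC; case: eqP => // ->; rewrite v0S.
case=> c e; have : (esum2 S * z) \mPo t = 0 by rewrite e rmorphM /= ht0 mulr0.
rewrite rmorphM => /eqP; rewrite mulf_eq0 => /orP[|] /eqP zt0; last first.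
  by rewrite -[z]subr0 -zt0; apply: divt.
have [d] := divt (esum2 S); rewrite zt0 subr0.
(* At this point e1 vanishes while e2 equals -1, in any characteristic. *)
pose pt i : k := if i == v0 then -1 else if i == v1 then 1 else 0.
have pt0 : pt v0 = -1 by rewrite /pt eqxx.
have pt1 : pt v1 = 1 by rewrite /pt eqxx (negPf v10).
have ptn i : i != v0 -> i != v1 -> pt i = 0.
  by move=> /negPf h0 /negPf h1; rewrite /pt h0 h1.
move/(congr1 (meval pt)); rewrite mevalM.
have -> : meval pt h = 0.
  rewrite /h raddf_sum /= (bigD1 v0) //= (bigD1 v1) /= ?v1S ?v10 // big1 ?addr0.
    by rewrite !mevalXU pt0 pt1 addNr.
  by move=> i /andP[/andP[_ i0] i1]; rewrite mevalXU ptn.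
rewrite mulr0 /esum2 raddf_sum /= (bigD1 v0) //= raddf_sum /=.
rewrite (bigD1 v1) /=; last by rewrite v1S.
rewrite !big1 ?addr0 => [|v /andP[vS vn0]|w /andP[/andP[wS v0w] wn1]].
- by rewrite mevalM !mevalXU pt0 pt1 mulr1 => /eqP; rewrite oppr_eq0 oner_eq0.
- rewrite raddf_sum big1 //= => w /andP[wS vw]; rewrite mevalM !mevalXU.
  have [e1|vn1] := eqVneq v v1; last by rewrite ptn // mul0r.
  rewrite [pt w]ptn ?mulr0 // -val_eqE gtn_eqF // -?e1 //.
  by apply: leq_trans vw; rewrite e1 ltnS ltnW.
- by rewrite mevalM !mevalXU [pt w]ptn ?mulr0 // -val_eqE gtn_eqF.
Qed.

End ElementaryPair.

(** For a face [F], this is positive dimension of its link. *)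
Definition link_has_edge (V : finType) (D : simplicial_complex V) (F : {set V}) :=
  exists u w, [/\ u != w, u \notin F, w \notin F & u |: (w |: F) \in faces D].

(** Connectedness through cuts rather than paths, the form used in both directions of the
    criterion. *)
Definition link_connected (V : finType) (D : simplicial_complex V) (F : {set V}) :=
  forall (X : {set V}) a b, a \in X -> b \notin X -> a \notin F -> b \notin F ->
    a |: F \in faces D -> b |: F \in faces D ->
  exists v w, [/\ v \in X, w \notin X, v \notin F, w \notin F
    & v |: (w |: F) \in faces D].

(** * Regular sequences at a prime, from connectedness of the link *)

Section LocalSerre.
Variables (k : fieldType) (N : nat) (D : simplicial_complex 'I_N).
Local Notation A := {mpoly k[N]}.
Variables (B : comNzRingType) (f : {rmorphism A -> B}) (Q : A -> Prop).
Hypothesis locf : is_localization f Q.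
Hypothesis kerf : forall a, f a = 0 <-> exists u, ~ Q u /\ sr_ideal D (u * a).
Let hQ := loc_prime locf.
Implicit Types (a b p z y : A) (G H : {set 'I_N}).

Variable F : {set 'I_N}.
Hypotheses (QF : forall v, v \notin F -> Q 'X_v) (nQF : forall v, v \in F -> ~ Q 'X_v).

Lemma loc_face_monomial : ~ Q (face_monomial k F).
Proof. by move/(is_prime_prod hQ) => [v [_ /nQF]]. Qed.

Lemma sr_ideal_ker a : sr_ideal D a -> f a = 0.
Proof.
move=> Ia; apply/kerf; exists 1; rewrite mul1r; split=> //.
exact: is_prime1 hQ.
Qed.

Lemma ker_prime a : f a = 0 -> Q a.
Proof.
move=> fa; apply: contrapT => /(loc_unit locf)[y]; rewrite fa mul0r => /eqP.
by rewrite eq_sym oner_eq0.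
Qed.

Lemma loc_face_in : F \in D.
Proof.
apply: contrapT => /negP FD; apply: loc_face_monomial; apply: ker_prime.
apply: sr_ideal_ker; apply/sr_idealP => H HD; rewrite restr_face_monomial ifN //.
by apply: contra FD => sub; apply: facesS sub HD.
Qed.

(** The monomial of [F] is outside [Q] and vanishes on every face not containing [F], so only the
    faces above [F] matter; on these, restriction factors through a facet. *)
Lemma loc_kerP a : f a = 0 <-> forall H, facet_above D F H -> restr H a = 0.
Proof.
split=> [/kerf[u [Qu /sr_idealP Ia]] H [+ _]|h].
  rewrite inE => /andP[HD FH]; have /eqP := Ia H HD.
  rewrite rmorphM mulf_eq0 => /orP[/eqP u0|/eqP //]; case: Qu.
  apply/(is_prime_restrP u hQ (F := H)); last by rewrite u0; apply: is_prime0.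
  by move=> v vH; apply: QF; apply: contra vH; apply/subsetP.
apply/kerf; exists (face_monomial k F); split; first exact: loc_face_monomial.
apply/sr_idealP => G GD; rewrite rmorphM /= restr_face_monomial.
case: ifP => FG; last by rewrite mul0r.
have [|H HF GH] := @facet_above_exists _ D F G; first by rewrite inE GD.
by rewrite -(restr_sub a GH) h // rmorph0 mulr0.
Qed.

Lemma regular_facets a : (forall H, facet_above D F H -> restr H a != 0) ->
  forall z, f (a * z) = 0 -> f z = 0.
Proof.
move=> ha z /loc_kerP az; apply/loc_kerP => H HF; have /eqP := az H HF.
by rewrite rmorphM mulf_eq0 (negPf (ha H HF)) => /eqP.
Qed.

(** Coprimality on a facet [H] yields a quotient [w H] of [z] by [a]. Two quotients agree on an
    intersection larger than [F] because [a] is nonzero there and cancels; agreement on [F] itself,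
    where [a] may vanish, is the last hypothesis. *)
Lemma loc_depth2_facets a b : Q a -> Q b ->
  (forall H, facet_above D F H -> restr H a != 0) ->
  (forall G, G \in star D F -> G != F -> restr G a != 0) ->
  (forall H z, facet_above D F H ->
     divides (restr H a) (restr H b * z) -> divides (restr H a) z) ->
  (forall z y (w : {set 'I_N} -> A),
     (forall H, facet_above D F H -> [/\ restr H (w H) = w H,
        restr H z = w H * restr H a & restr H y = w H * restr H b]) ->
     forall H H', facet_above D F H -> facet_above D F H' ->
       restr F (w H) = restr F (w H')) ->
  depth_ge B 2.
Proof.
move=> Qa Qb a0 aG cop glueF.
apply: (loc_depth_ge2 locf Qa Qb); first exact: regular_facets.
move=> z y e.
have {}e H : facet_above D F H -> restr H b * restr H z = restr H a * restr H y.
  have /loc_kerP h : f (b * z - a * y) = 0 by rewrite rmorphB /= e subrr.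
  move=> /h.
  by rewrite rmorphB !rmorphM /= => /eqP; rewrite subr_eq0 => /eqP.
have /choice[w wP] (H : {set 'I_N}) : exists w, facet_above D F H ->
    [/\ restr H w = w, restr H z = w * restr H a & restr H y = w * restr H b].
  have [HF|nHF] := pselect (facet_above D F H); last by exists 0.
  have [|c cE] := cop H (restr H z) HF.
    by exists (restr H y); rewrite (e H HF); apply: mulrC.
  exists (restr H c) => _; have zE : restr H z = restr H c * restr H a.
    by have := congr1 (restr H) cE; rewrite rmorphM /= !restr_restr setIid.
  split; [by rewrite restr_restr setIid|exact: zE|].
  by apply: (mulfI (a0 H HF)); rewrite -(e H HF) zE; ring.
have [H H' HF H'F|W WE] := @glue_facets k N D F w.
  have GF : H :&: H' \in star D F.
    move: (HF) (H'F) => [+ _] [+ _]; rewrite !inE => /andP[HD FH] /andP[_ FH'].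
    by rewrite subsetI FH FH' !andbT; apply: facesS (subsetIl H H') HD.
  have [->|GneF] := eqVneq (H :&: H') F; first exact: (glueF z y).
  apply: (mulIf (aG _ GF GneF)).
  have [_ zH _] := wP H HF; have [_ zH' _] := wP H' H'F.
  transitivity (restr (H :&: H') z).
    rewrite -(restr_sub z (subsetIl H H')) zH rmorphM /= (restr_sub _ (subsetIl H H')).
    reflexivity.
  rewrite -(restr_sub z (subsetIr H H')) zH' rmorphM /= (restr_sub _ (subsetIr H H')).
  reflexivity.
exists W; apply/eqP; rewrite -subr_eq0 -rmorphB; apply/eqP/loc_kerP => H HF.
have [wH zH _] := wP H HF.
by rewrite rmorphB rmorphM /= WE // wH zH; ring.
Qed.

Local Notation e1 := (esum1 k (~: F)).
Local Notation e2 := (esum2 k (~: F)).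

Lemma loc_esum1 : Q e1.
Proof.
apply: (is_prime_sum _ hQ) => v; rewrite inE; exact: QF.
Qed.

Lemma loc_esum2 : Q e2.
Proof.
apply: (is_prime_sum _ hQ) => v vF; apply: (is_prime_sum _ hQ) => w _.
by apply: (is_primeMr hQ); apply: QF; rewrite inE in vF.
Qed.

Lemma setICD H : ~: F :&: H = H :\: F.
Proof. by rewrite setDE setIC. Qed.

Lemma star_esum1 G : G \in star D F -> G != F -> restr G e1 != 0.
Proof.
rewrite inE => /andP[_ FG] GF; rewrite restr_esum1 setICD.
have /subsetPn[v vG vF] : ~~ (G \subset F).
  by apply: contra GF => GF; rewrite eqEsubset GF.
by apply: (@esum1_neq0 _ _ _ v); rewrite inE vF.
Qed.

Lemma facet_neq v H : v \notin F -> v |: F \in D -> facet_above D F H -> H != F.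
Proof.
move=> vF vFD [_ Hmax]; apply: contraNneq vF => HF.
have := Hmax (v |: F); rewrite inE vFD HF !subsetUr => /(_ isT isT) <-.
by rewrite setU11.
Qed.

Lemma facet_esum1 v H : v \notin F -> v |: F \in D -> facet_above D F H ->
  restr H e1 != 0.
Proof.
by move=> vF vFD HF; apply: star_esum1 (proj1 HF) _; apply: (facet_neq vF).
Qed.

Lemma loc_depth_ge1_link v : v \notin F -> v |: F \in D -> depth_ge B 1.
Proof.
move=> vF vFD; apply: (loc_depth_ge1 locf loc_esum1).
by apply: regular_facets => H; apply: facet_esum1 vF vFD.
Qed.

(** The vertices of the facets with the same value of [r] as [H] form a set that no edge of the link
    leaves. *)
Lemma link_connected_facets T (r : {set 'I_N} -> T) :
  link_connected D F ->
  (forall H H', facet_above D F H -> facet_above D F H' ->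
     H :&: H' != F -> r H = r H') ->
  forall v H H', v \notin F -> v |: F \in D ->
    facet_above D F H -> facet_above D F H' -> r H = r H'.
Proof.
move=> conn rI v0 H H' v0F v0FD HF H'F.
pose X := [set v | `[< exists H1, [/\ facet_above D F H1, v \in H1 & r H1 = r H] >]].
have neqI v H1 H2 : v \notin F -> v \in H1 -> v \in H2 -> H1 :&: H2 != F.
  by move=> vF v1 v2; apply: contraNneq vF => <-; rewrite inE v1.
have outside G : facet_above D F G -> exists2 v, v \in G & v \notin F.
  move=> GF; apply/subsetPn; apply: contra (facet_neq v0F v0FD GF).
  by case: GF => [+ _]; rewrite inE eqEsubset => /andP[_ ->] ->.
have inD G v : facet_above D F G -> v \in G -> v |: F \in D.
  case=> [+ _] vG; rewrite inE => /andP[GD FG]; apply: facesS GD.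
  by rewrite subUset sub1set vG.
have [v vH vF] := outside H HF; have [w wH' wF] := outside H' H'F.
have vX : v \in X by rewrite inE; apply/asboolP; exists H.
have wX : w \in X.
  apply: contrapT => /negP wX.
  have [x [y [xX yX xF yF xyD]]] :=
    conn X v w vX wX vF wF (inD _ _ HF vH) (inD _ _ H'F wH').
  move: xX; rewrite inE => /asboolP[H1 [H1F xH1 rH1]].
  have [|H2 H2F] := @facet_above_exists _ D F (x |: (y |: F)).
    by rewrite inE xyD (subset_trans (subsetUr [set y] F)) ?subsetUr.
  rewrite !subUset !sub1set => /and3P[xH2 yH2 _].
  case/negP: yX; rewrite inE; apply/asboolP; exists H2; split=> //.
  by rewrite -rH1; apply: rI => //; apply: (neqI x).
move: wX; rewrite inE => /asboolP[H1 [H1F wH1 <-]].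
by apply: rI => //; apply: (neqI w).
Qed.

Lemma loc_depth_ge2_connected :
  link_has_edge D F -> link_connected D F -> depth_ge B 2.
Proof.
move=> [u [w0 [uw uF w0F uwD]]] conn.
have uFD : u |: F \in D by apply: facesS uwD; apply: setUS; apply: subsetUr.
have w0FD : w0 |: F \in D by apply: facesS uwD; apply: subsetUr.
apply: (loc_depth2_facets loc_esum1 loc_esum2).
- by move=> H; apply: facet_esum1 uF uFD.
- exact: star_esum1.
- move=> H z HF; rewrite restr_esum1 restr_esum2 setICD.
  suff [v [w [vH wH vw]]] : exists v w, [/\ v \in H :\: F, w \in H :\: F & (v < w)%N].
    exact: esum12_coprime vH wH vw.
  suff [v [w [vH wH]]] : exists v w, [/\ v \in H :\: F, w \in H :\: F & v != w].
    by rewrite -val_eqE neq_ltn => /orP[] vw; [exists v, w|exists w, v].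
  have [x xH xF] : exists2 v, v \in H & v \notin F.
    apply/subsetPn; apply: contra (facet_neq uF uFD HF).
    by case: (HF) => [+ _]; rewrite inE eqEsubset => /andP[_ ->] ->.
  have [y [yx yF yFD]] : exists y : 'I_N, [/\ y != x, y \notin F & y |: F \in D].
    by have [<-|] := eqVneq u x; [exists w0; rewrite eq_sym|exists u].
  case: (HF) => [+ Hmax]; rewrite inE => /andP[HD FH].
  have xFD : x |: F \in D by apply: facesS HD; rewrite subUset sub1set xH.
  (* The cut around [x] provides an edge at [x], so [x |: F] is not maximal and [H] has a second
     vertex outside [F]. *)
  have [|v [w [+ + vF wF vwD]]] := conn [set x] x y (set11 x) _ xF yF xFD yFD.
    by rewrite inE.
  rewrite !inE => /eqP vx wx; rewrite {}vx in vF vwD *.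
  have [z' [z'H z'F z'x]] : exists z' : 'I_N, [/\ z' \in H, z' \notin F & z' != x].
    apply: contrapT => none; have HE : H = x |: F.
      apply/eqP; rewrite eqEsubset subUset sub1set xH FH !andbT.
      apply/subsetP => z' z'H; rewrite !inE; apply: contrapT => /negP.
      by rewrite negb_or => /andP[z'x z'F]; apply: none; exists z'.
    have xwF : x |: (w |: F) \in star D F.
      by rewrite inE vwD (subset_trans (subsetUr [set w] F)) ?subsetUr.
    have := Hmax _ xwF; rewrite HE setUS ?subsetUr // => /(_ isT) /setP/(_ w).
    by rewrite !inE eqxx (negPf wx) (negPf wF).
  by exists x, z'; rewrite !inE xH xF z'H z'F eq_sym.
move=> z y w wP H H' HF H'F.
(* When two facets meet outside [F], e1 is nonzero on the intersection, so the quotients agree there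
   and hence on [F]; connectedness propagates this to all facets. *)
apply: (@link_connected_facets _ (fun G => restr F (w G)) conn _ u) => //.
move=> H1 H2 H1F H2F GneF.
have [G1 G2] := (subsetIl H1 H2, subsetIr H1 H2).
have GF : H1 :&: H2 \in star D F.
  move: (H1F) (H2F) => [+ _] [+ _]; rewrite !inE => /andP[HD FH] /andP[_ FH'].
  by rewrite subsetI FH FH' !andbT; apply: facesS G1 HD.
have FG : F \subset H1 :&: H2 by move: GF; rewrite inE => /andP[].
rewrite -(restr_sub (w H1) FG) -(restr_sub (w H2) FG); congr (restr F _).
apply: (mulIf (star_esum1 GF GneF)).
have [_ z1 _] := wP H1 H1F; have [_ z2 _] := wP H2 H2F.
transitivity (restr (H1 :&: H2) z).
  rewrite -(restr_sub z G1) z1 rmorphM /= (restr_sub _ G1); reflexivity.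
rewrite -(restr_sub z G2) z2 rmorphM /= (restr_sub _ G2); reflexivity.
Qed.

(** * Links without edges: using a chain of primes *)

Section Chains.
Variables P0 P1 : A -> Prop.
Hypotheses (hP0 : is_prime P0) (hP1 : is_prime P1).
Hypotheses (K0 : forall a, f a = 0 -> P0 a) (sub01 : forall a, P0 a -> P1 a).
Hypothesis sub1 : forall a, P1 a -> Q a.
Hypothesis lt01 : exists a, P1 a /\ ~ P0 a.

(** The monomial of a non-face maps to 0, so one of its variables is in [P0]; those of [F] are not
    even in [Q]. *)
Lemma chain_nonface S : S :|: F \notin D -> exists2 v, v \in S & P0 'X_v.
Proof.
move=> SD; have : P0 (face_monomial k S * face_monomial k F).
  apply: K0; apply: sr_ideal_ker; apply/sr_idealP => H HD.
  rewrite rmorphM /= !restr_face_monomial; case: ifP => SH; last by rewrite mul0r.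
  case: ifP => FH; last by rewrite mulr0.
  by move: SD; rewrite (facesS _ HD) // subUset SH.
case/(is_primeM hP0) => [/(is_prime_prod hP0)[v [_ vS Pv]]|]; first by exists v.
by move/sub01/sub1/loc_face_monomial.
Qed.

Lemma chain_facet_vars : (forall v, v \notin F -> v |: F \notin D) ->
  forall v, v \notin F -> P0 'X_v.
Proof.
move=> facF v /facF /chain_nonface[w]; by rewrite inE => /eqP ->.
Qed.

Lemma chain_facet_regular : (forall v, v \notin F -> v |: F \notin D) ->
  exists2 a, P1 a & restr F a != 0.
Proof.
move=> facF; have [a [Pa nPa]] := lt01; exists a => //.
apply/eqP => Fa; apply: nPa.
apply/(is_prime_restrP a hP0 (chain_facet_vars facF)).
by rewrite Fa; apply: is_prime0.
Qed.

Lemma facet_above_facet H : (forall v, v \notin F -> v |: F \notin D) ->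
  H \in star D F -> H = F.
Proof.
move=> facF; rewrite inE => /andP[HD FH]; apply/eqP; rewrite eqEsubset FH andbT.
apply/subsetP => v vH; apply: contrapT => /negP /facF /negP; apply.
by apply: facesS HD; rewrite subUset sub1set vH.
Qed.

Lemma chain_facet_depth_ge1 : (forall v, v \notin F -> v |: F \notin D) ->
  depth_ge B 1.
Proof.
move=> facF; have [a P1a a0] := chain_facet_regular facF.
apply: (loc_depth_ge1 locf (sub1 P1a)); apply: regular_facets => H [HF _].
by rewrite (facet_above_facet facF HF).
Qed.

(* A nonzero element of [P1] of minimal degree that only involves the         *)
(* variables of [F] has a prime factor in [P1], hence is that prime factor up *)
(* to a constant.                                                             *)
Lemma chain_facet_prime_like : (forall v, v \notin F -> v |: F \notin D) ->
  exists a, [/\ P1 a, a != 0, restr F a = a & prime_like a].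
Proof.
move=> facF; pose ok a := [/\ P1 a, a != 0 & restr F a = a].
have P1X v : v \notin F -> P1 'X_v by move=> vF; apply: sub01; apply: chain_facet_vars.
have exn : exists n, `[< exists2 a, ok a & msize a = n >].
  have [b Pb b0] := chain_facet_regular facF.
  exists (msize (restr F b)); apply/asboolP; exists (restr F b) => //.
  split=> //; first exact/is_prime_restrP.
  by rewrite restr_restr setIid.
have [_ /asboolP[a [Pa a0 aF] <-] amin] := ex_minnP exn.
exists a; split=> //; have [s sP aE] := factorial_mpoly a0.
have [x [xs _ Px]] : exists x, [/\ x \in s, true & P1 x].
  by move: Pa; rewrite aE => /(is_prime_prod hP1).
have [h hE] : exists h, a = h * x.
  by exists (\prod_(y <- rem x s) y); rewrite aE (big_rem x xs) mulrC.
have /andP[h0 x0] : (h != 0) && (x != 0) by rewrite -negb_or -mulf_eq0 -hE.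
have Fa : restr F a = restr F h * restr F x by rewrite hE rmorphM.
have okx : ok (restr F x).
  split; [exact/is_prime_restrP| |by rewrite restr_restr setIid].
  by apply: contra_neq a0 => x00; rewrite -aF Fa x00 mulr0.
have le1 : (msize a <= msize (restr F x))%N.
  by apply: amin; apply/asboolP; exists (restr F x).
have le2 := msize_restr F x.
have szE : msize a = (msize h + msize x).-1 by rewrite hE msizeM.
have h1 : (msize h <= 1)%N.
  have : (0 < msize x)%N by rewrite lt0n msize_poly_eq0.
  move: (leq_trans le1 le2); rewrite szE; clear; case: (msize x) => // n + _.
  by rewrite addnS /= -add1n leq_add2r.
have hC := msize1_polyC h1.
have c0 : h@_0 != 0 by apply: contra_neq h0 => c0; rewrite hC c0.
rewrite hE; apply: prime_like_mul_unit (sP x xs).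
apply/unitrP; exists (h@_0)^-1%:MP; rewrite hC mcoeffC eqxx mulr1 -!mpolyCM.
by rewrite mulVf // mulfV.
Qed.

Variable P2 : A -> Prop.
Hypotheses (sub12 : forall a, P1 a -> P2 a) (sub2 : forall a, P2 a -> Q a).
Hypothesis lt12 : exists a, P2 a /\ ~ P1 a.

(** The prime-like [a] in [P1] is paired with some [b] in [P2] but not in [P1]: if [a] divided [b]
    on [F], then [b] would be in [P1]. As [F] is the only facet above itself, there is nothing to
    glue. *)
Lemma chain_facet_depth_ge2 : (forall v, v \notin F -> v |: F \notin D) ->
  depth_ge B 2.
Proof.
move=> facF; have [a [Pa a0 aF pa]] := chain_facet_prime_like facF.
have P1X v : v \notin F -> P1 'X_v by move=> vF; apply: sub01; apply: chain_facet_vars.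
have [b P2b nab] : exists2 b, P2 b & ~ divides a (restr F b).
  have [b [P2b nP1b]] := lt12; exists b => // -[c cE]; apply: nP1b.
  apply/(is_prime_restrP b hP1 P1X); rewrite cE; exact: is_primeMl.
have facE H : facet_above D F H -> H = F by case=> /(facet_above_facet facF).
apply: (loc_depth2_facets (sub1 Pa) (sub2 P2b)).
- by move=> H /facE ->; rewrite aF.
- by move=> G /(facet_above_facet facF) ->; rewrite eqxx.
- by move=> H z /facE -> ; rewrite aF => /pa[].
- by move=> z y w _ H H' /facE -> /facE ->.
Qed.

(** Suppose [P2] vanishes on [F]. Then some variable ['X_v] outside [F] is not in [P0], all other
    outside variables are in [P0] since the link has no edge, and ['X_v] is not in [P1] since [P1]
    differs from [P2]. Modulo [P0], an element of [P1] is divisible by ['X_v], with quotient in [P1]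
    of smaller degree; descent gives [P1] inside [P0], a contradiction. *)
Lemma chain_points_regular : ~ link_has_edge D F ->
  (exists2 v, v \notin F & v |: F \in D) -> exists2 b, P2 b & restr F b != 0.
Proof.
move=> noedge [v0 v0F v0D]; apply: contrapT => none.
have {}none b : P2 b -> restr F b = 0.
  by move=> P2b; apply: contrapT => /eqP b0; apply: none; exists b.
have allvars (P : A -> Prop) : is_prime P -> (forall v, v \notin F -> P 'X_v) ->
    forall b, P2 b -> P b.
  move=> hP PX b /none Fb; apply/(is_prime_restrP b hP PX).
  by rewrite Fb; apply: is_prime0.
have [x [P1x nP0x]] := lt01; have [y [P2y nP1y]] := lt12.
have [v vF nP0v] : exists2 v, v \notin F & ~ P0 'X_v.
  apply: contrapT => h; apply: nP0x; apply: (allvars _ hP0) (sub12 P1x).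
  by move=> v vF; apply: contrapT => nv; apply: h; exists v.
have P0w w : w \notin F -> w != v -> P0 'X_w.
  move=> wF wv; have [|w' ] := @chain_nonface [set w; v].
    by apply/negP => wvD; apply: noedge; exists w, v; rewrite setUA.
  by rewrite !inE => /orP[]/eqP->.
have nP1v : ~ P1 'X_v.
  move=> P1v; apply: nP1y; apply: (allvars _ hP1) P2y => w wF.
  by have [->//|wv] := eqVneq w v; apply: sub01; apply: P0w.
have P0H w : w \notin v |: F -> P0 'X_w.
  by rewrite !inE negb_or => /andP[wv wF]; apply: P0w.
apply: nP0x; move: x P1x {P2y nP1y y}.
suff H n : forall x, (msize x < n)%N -> P1 x -> P0 x.
  by move=> x; apply: (H (msize x).+1).
elim: n => // n IHn x szx P1x.
pose x' := restr (v |: F) x.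
have P1x' : P1 x' by apply/is_prime_restrP => // w /P0H; apply: sub01.
apply/(is_prime_restrP x hP0 P0H); rewrite -/x'.
have [->|x'0] := eqVneq x' 0; first exact: is_prime0.
have [c cE] : divides 'X_v x'.
  apply: restr_eq0_divides; rewrite restr_restr.
  apply: etrans (none x (sub12 P1x)); congr (restr _ x); apply/setP => w; rewrite !inE.
  by have [->|] := eqVneq w v; rewrite //= (negPf vF).
have c0 : c != 0 by apply: contra_neq x'0 => c0; rewrite cE c0 mul0r.
rewrite cE; apply: (is_primeMr hP0); apply: IHn; last first.
  by move: P1x'; rewrite cE => /(is_primeM hP1)[].
have X0 : ('X_v : A) != 0 by rewrite -msize_poly_eq0 msizeX.
have := msize_restr (v |: F) x; rewrite -/x' cE msizeM // msizeX mdeg1 addn2 /=.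
by move=> h; apply: leq_trans h szx.
Qed.

(** The facets are the [v |: F], on which e1 restricts to ['X_v], coprime to a nonzero [b] in the
    variables of [F]. On [F] the quotients agree because [b] times each of them is the restriction
    of [y]. *)
Lemma chain_points_depth_ge2 : ~ link_has_edge D F ->
  (exists2 v, v \notin F & v |: F \in D) -> depth_ge B 2.
Proof.
move=> noedge exv; have [b0 P2b0 Fb0] := chain_points_regular noedge exv.
have [v0 v0F v0D] := exv.
have [b [Qb Fb b_neq0]] : exists b, [/\ Q b, restr F b = b & b != 0].
  exists (restr F b0); rewrite restr_restr setIid; split=> //.
  by apply/is_prime_restrP; [exact: hQ|exact: QF|exact: sub2].
have facE H : facet_above D F H -> exists2 v, v \notin F & H = v |: F.
  move=> HF; have HneF := facet_neq v0F v0D HF.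
  case: HF => [+ _]; rewrite inE => /andP[HD FH].
  have /subsetPn[v vH vF] : ~~ (H \subset F).
    by apply: contra HneF => sub; rewrite eqEsubset sub.
  exists v => //; apply/eqP; rewrite eqEsubset subUset sub1set vH FH !andbT.
  apply/subsetP => w wH; rewrite !inE; apply: contrapT => /negP.
  rewrite negb_or => /andP[wv wF]; apply: noedge; exists w, v; split=> //.
  by apply: facesS HD; rewrite !subUset !sub1set wH vH.
have Hb H : F \subset H -> restr H b = b.
  by move=> /setIidPr sub; rewrite -{1}Fb restr_restr sub.
apply: (loc_depth2_facets loc_esum1 Qb).
- by move=> H; apply: facet_esum1 v0F v0D.
- exact: star_esum1.
- move=> H z /facE[v vF ->]; rewrite Hb ?subsetUr // restr_esum1.
  have -> : ~: F :&: (v |: F) = [set v].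
    by apply/setP => w; rewrite !inE; have [->|] := eqVneq w v; rewrite ?vF //= andNb.
  rewrite /esum1 big_set1 => -[c cE]; apply: restr_eq0_divides.
  have /eqP : restr [set~ v] (b * z) = 0 by rewrite cE rmorphM /= restrX !inE eqxx mulr0.
  rewrite rmorphM mulf_eq0 => /orP[|/eqP //] /= /eqP b00; case/eqP: b_neq0.
  rewrite -(Hb [set~ v]) //; apply/subsetP => w wF.
  by rewrite !inE; apply: contraNneq vF => <-.
move=> z y w wP H H' HF H'F; apply: (mulIf b_neq0).
have FH G : facet_above D F G -> F \subset G.
  by case=> [+ _]; rewrite inE => /andP[].
have yE G : facet_above D F G -> restr F y = restr F (w G) * b.
  move=> GF; have [_ _ y1] := wP G GF.
  by rewrite -(restr_sub y (FH _ GF)) y1 rmorphM /= (Hb _ (FH _ GF)) Fb.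
by rewrite -(yE H HF) -(yE H' H'F).
Qed.

End Chains.

Lemma loc_serre2 : (link_has_edge D F -> link_connected D F) ->
  forall i, (i <= 2)%N -> krull_dim_ge B i -> depth_ge B i.
Proof.
move=> conn; have vP : (exists2 v, v \notin F & v |: F \in D) \/
    (forall v, v \notin F -> v |: F \notin D).
  have [|h] := pselect (exists2 v, v \notin F & v |: F \in D); first by left.
  by right=> v vF; apply/negP => vD; apply: h; exists v.
move=> [|[|[|//]]] _ dimB; first exact: loc_depth_ge0.
  have [[v vF vD]|facF] := vP; first exact: (loc_depth_ge1_link vF).
  have [P [hP KP PQ /(_ ord0 ord_max isT)[sP ltP]]] := loc_krull_dim_ge locf dimB.
  exact: (chain_facet_depth_ge1 (hP ord0) (KP ord0) sP (PQ ord_max) ltP).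
have [edge|noedge] := pselect (link_has_edge D F).
  by apply: loc_depth_ge2_connected => //; apply: conn.
have [P [hP KP PQ ltP]] := loc_krull_dim_ge locf dimB.
pose i1 : 'I_3 := Ordinal (isT : (1 < 3)%N).
have [s01 lt01] := ltP ord0 i1 isT; have [s12 lt12] := ltP i1 ord_max isT.
have [exv|facF] := vP.
  exact: (chain_points_depth_ge2 (hP _) (hP _) (KP _) s01 (PQ _) lt01 s12 (PQ _) lt12).
exact: (chain_facet_depth_ge2 (hP _) (hP _) (KP _) s01 (PQ _) lt01 (PQ _) lt12).
Qed.

End LocalSerre.

(** * A disconnected link forces depth below 2 *)

Section DisconnectedLink.
Variables (k : fieldType) (N : nat) (D : simplicial_complex 'I_N) (F : {set 'I_N}).
Local Notation A := {mpoly k[N]}.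
Variables (B : comNzRingType) (f : {rmorphism A -> B}).
Local Notation Q := (fun a : A => restr F a = 0).
Hypothesis locf : is_localization f Q.
Hypothesis kerf : forall a, f a = 0 <-> exists u, ~ Q u /\ sr_ideal D (u * a).

Implicit Types (X H : {set 'I_N}) (a : A).

Lemma face_ker H a : H \in D -> F \subset H -> f a = 0 -> restr H a = 0.
Proof.
move=> HD FH /kerf[u [Qu /sr_idealP/(_ H HD)/eqP]].
rewrite rmorphM mulf_eq0 => /orP[/eqP u0|/eqP//]; case: Qu.
by rewrite -(restr_sub u FH) u0 rmorph0.
Qed.

Lemma edge_krull_dim_ge2 : link_has_edge D F -> krull_dim_ge B 2.
Proof.
case=> u [w [uw uF wF uwD]].
have sub1 : F \subset w |: F by apply: subsetUr.
have sub2 : w |: F \subset u |: (w |: F) by apply: subsetUr.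
have sub12 := subset_trans sub1 sub2.
(* The faces decrease, so their primes increase; the third face is the default value [F] of
   [nth]. *)
pose S (i : 'I_3) := nth F [:: u |: (w |: F); w |: F] i.
have SF i : F \subset S i by case: i => -[|[|[|//]]] ?.
have SD i : S i \in D.
  by apply: (facesS _ uwD); case: i => -[|[|[|//]]] ?; rewrite /S //=
    subUset sub1set setU11 sub12.
apply: (@loc_krull_dim_ge_intro _ _ f Q locf 2 (fun i a => restr (S i) a = 0)).
- by move=> i; apply: restr_prime.
- by move=> i a; apply: face_ker.
- by move=> i a a0; rewrite -(restr_sub a (SF i)) a0 rmorph0.
have X_neq0 i v : v \in S i -> restr (S i) 'X_v <> 0 :> A.
  move=> vS; rewrite restrX vS => /eqP; by rewrite -msize_poly_eq0 msizeX.
move=> i j ij; have Sji : S j \subset S i.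
  by case: i j ij => -[|[|[|//]]] ? [[|[|[|//]]] ?].
split=> [a ai|]; first by rewrite -(restr_sub a Sji) ai rmorph0.
have [v vi vj] : exists2 v, v \in S i & v \notin S j.
  case: i j ij {Sji} => -[|[|[|//]]] ? [[|[|[|//]]] ?] //= _; rewrite /S /=.
  - by exists u; rewrite !inE ?eqxx // (negPf uw) (negPf uF).
  - by exists u; rewrite ?setU11.
  - by exists w; rewrite ?setU11.
exists 'X_v; split; last exact: X_neq0.
by rewrite restrX (negPf vj).
Qed.

Definition var_span (X : {set 'I_N}) (z : B) :=
  exists c : 'I_N -> B, z = \sum_(v | (v \notin F) && (v \in X)) c v * f 'X_v.

Lemma var_span_var X v : v \in X -> v \notin F -> var_span X (f 'X_v).
Proof.
move=> vX vF; exists (fun w => (w == v)%:R); rewrite (bigD1 v) /= ?vX ?vF //.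
by rewrite eqxx mul1r big1 ?addr0 // => w /andP[_ /negPf->]; rewrite mul0r.
Qed.

Lemma nonunit_span X (x : B) : ~ invertible x ->
  exists y z, [/\ x = y + z, var_span X y & var_span (~: X) z].
Proof.
move=> nx; have [a [s [Qs e]]] := loc_frac locf x.
have [t st] := loc_unit locf Qs.
have Qa : Q a.
  apply: contrapT => /(loc_unit locf)[v av]; apply: nx; exists (f s * v).
  by rewrite mulrCA mulrA e.
have [c aE] := restr_eq0 Qa.
have -> : x = t * f a by rewrite -e mulrA [t * _]mulrC st mul1r.
rewrite aE rmorph_sum mulr_sumr (bigID (mem X)) /=.
exists (\sum_(v | (v \notin F) && (v \in X)) t * f (c v * 'X_v)).
exists (\sum_(v | (v \notin F) && (v \notin X)) t * f (c v * 'X_v)).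
split=> //; exists (fun v => t * f (c v)).
  by apply: eq_bigr => v _; rewrite rmorphM mulrA.
by apply: eq_big => v; [rewrite inE|rewrite rmorphM mulrA].
Qed.

Lemma unit_or_unit1B (c : B) : invertible c \/ invertible (1 - c).
Proof.
have [a [s [Qs e]]] := loc_frac locf c; have [t st] := loc_unit locf Qs.
have [Qa|/(loc_unit locf)[v av]] := pselect (Q a); last first.
  by left; exists (f s * v); rewrite mulrCA mulrA e.
right; have [|v av] := @loc_unit _ _ _ _ locf (s - a).
  by rewrite rmorphB /= Qa subr0.
by exists (f s * v); rewrite mulrCA mulrA mulrBr mulr1 e -rmorphB av.
Qed.

Lemma disconnected_not_depth_ge2 X (a b : 'I_N) :
  a \in X -> b \notin X -> a \notin F -> b \notin F ->
  a |: F \in D -> b |: F \in D ->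
  (forall v w, v \in X -> w \notin X -> v \notin F -> w \notin F ->
     v |: (w |: F) \notin D) ->
  ~ depth_ge B 2.
Proof.
move=> aX bX aF bF aD bD sep /depth_ge2P[x [y [nx ny regx regy]]].
have Xker v : v \notin F -> v |: F \in D -> f 'X_v <> 0.
  move=> vF vD /(face_ker vD (subsetUr _ _)) /eqP.
  by rewrite restrX setU11 -msize_poly_eq0 msizeX.
have XX v w : v \in X -> w \notin X -> v \notin F -> w \notin F -> f 'X_v * f 'X_w = 0.
  move=> vX wX vF wF; rewrite -rmorphM; apply/kerf; exists (face_monomial k F).
  split.
    rewrite restr_face_monomial subxx face_monomialE => /eqP.
    by rewrite -msize_poly_eq0 msizeX.
  apply/sr_idealP => H HD; rewrite !rmorphM /= restr_face_monomial !restrX.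
  case: ifP => [FH|_]; last by rewrite mul0r.
  case: ifP => [vH|_]; last by rewrite mul0r mulr0.
  case: ifP => [wH|_]; last by rewrite !mulr0.
  have /negP[] := sep v w vX wX vF wF; apply: facesS HD.
  by rewrite !subUset !sub1set vH wH.
have JJ p q : var_span X p -> var_span (~: X) q -> p * q = 0.
  move=> [c ->] [d ->]; rewrite mulr_suml big1 // => v /andP[vF vX].
  rewrite mulr_sumr big1 // => w /andP[wF]; rewrite inE => wX.
  by rewrite mulrACA XX // mulr0.
have [x1 [x2 [xE Jx1 Jx2]]] := nonunit_span X nx.
have [y1 [y2 [yE Jy1 Jy2]]] := nonunit_span X ny.
have x12 := JJ _ _ Jx1 Jx2.
(* Both [y * x1] and [y1 * x] equal [y1 * x1], as the mixed products vanish. *)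
have [|c cE] := regy x1 y1.
  by rewrite xE yE mulrDl mulrDr [y2 * x1]mulrC (JJ x1 y2) // (JJ y1 x2).
have bV : b \in ~: X by rewrite inE.
have Jb := var_span_var bV bF; have Ja := var_span_var aX aF.
(* From [x1 = c * (x1 + x2)], one of [x1], [x2] is a multiple of the other. Since [x1 * x2 = 0],
   that one is killed by [x], so it is 0, and then [x] kills a nonzero variable from the opposite
   part. *)
have [[d cd]|[d cd]] := unit_or_unit1B c.
  have x2d : x2 = d * (1 - c) * x1.
    have -> : d * (1 - c) * x1 = d * x1 - c * d * x1 by ring.
    rewrite cd mul1r {1}cE xE; transitivity (c * d * (x1 + x2) - x1); last by ring.
    by rewrite cd; ring.
  have x20 : x2 = 0.
    apply: regx; rewrite xE mulrDl x12 add0r {1}x2d -mulrA x12 mulr0 //.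
  apply: (Xker b bF bD); apply: regx.
  by rewrite xE x20 addr0 (JJ _ _ Jx1 Jb).
have x1d : x1 = d * c * x2.
  transitivity ((1 - c) * d * x1); first by rewrite cd mul1r.
  transitivity (d * (x1 - c * x1)); first by ring.
  by rewrite {1}cE xE; ring.
have x10 : x1 = 0.
  apply: regx; rewrite xE mulrDl [x2 * _]mulrC x12 addr0 {2}x1d mulrCA x12 mulr0 //.
apply: (Xker a aF aD); apply: regx.
by rewrite xE x10 add0r mulrC (JJ _ _ Ja Jx2).
Qed.

End DisconnectedLink.

(** * Serre's condition in terms of links *)

Section Criterion.
Variables (k : fieldType) (N : nat) (D : simplicial_complex 'I_N).
Local Notation A := {mpoly k[N]}.
Local Notation R := (stanley_reisner_ring k D).

Lemma sr_quotient : exists q : {rmorphism A -> R},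
  (forall x, exists a, q a = x) /\ (forall a, q a = 0 <-> sr_ideal D a).
Proof.
pose I : idealr A := @sr_ideal k N D.
exists (\pi_({ideal_quot I}) : {rmorphism A -> {ideal_quot I}}).
split=> [x|a]; first by exists (repr x); apply: reprK.
have := Quotient.idealrBE I a 0; rewrite subr0 => E.
have p0 : \pi_({ideal_quot I}) 0 = 0 :=
  rmorph0 (\pi_({ideal_quot I}) : {rmorphism A -> _}).
split=> [/= a0|Ia]; first by rewrite -[sr_ideal D a]/(a \in I) E a0 p0.
by apply: etrans p0; apply/eqP; rewrite /= -E.
Qed.

Theorem serre2P : serre_condition 2 R <->
  forall F, F \in D -> link_has_edge D F -> link_connected D F.
Proof.
have [q [qsurj qker]] := sr_quotient; move: R q qsurj qker => R' q qsurj qker.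
have kerf (p : prime_idealr R') a : (loc p \o q) a = 0 <->
    exists u, ~ q u \in (p : {pred R'}) /\ sr_ideal D (u * a).
  rewrite /= loc_eq0; split=> [[x px xa]|[u [pu Iu]]].
    have [u uE] := qsurj x; exists u; rewrite uE; split; first exact/negP.
    by apply/qker; rewrite rmorphM uE.
  by exists (q u); [exact/negP|rewrite -rmorphM; apply/qker].
split=> [serre F FD edge X a b aX bX aF bF aD bD|conn p i i2 dimp]; last first.
  have locp := loc_comp (loc_is_localization p) qsurj.
  pose F := [set v | q 'X_v \notin (p : {pred R'})].
  have QF v : v \notin F -> q 'X_v \in (p : {pred R'}) by rewrite inE negbK.
  have nQF v : v \in F -> ~ q 'X_v \in (p : {pred R'}) by rewrite inE => /negP.
  apply: (loc_serre2 locp (kerf p) QF nQF) => //; apply: conn.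
  exact: (loc_face_in locp (kerf p) nQF).
apply: contrapT => sep.
(* The face prime of [F] in the quotient ring, at which the failure of depth is detected. *)
pose P x := exists2 a, q a = x & restr F a = 0.
have PE c : P (q c) <-> restr F c = 0.
  split=> [[d /eqP + dF]|cF]; last by exists c.
  rewrite -subr_eq0 -rmorphB => /eqP/qker/sr_idealP/(_ F FD).
  by rewrite rmorphB /= dF sub0r => /eqP; rewrite oppr_eq0 => /eqP.
have hF := @restr_prime k N F.
have hP : is_prime P.
  split.
  - by exists 0; rewrite rmorph0.
  - by move=> _ _ [c <- cF] [d <- dF]; exists (c + d); rewrite rmorphD //= cF dF addr0.
  - move=> x _ [d <- dF]; have [c <-] := qsurj x; exists (c * d); first exact: rmorphM.
    by rewrite rmorphM /= dF mulr0.
  - by rewrite -(rmorph1 q) => /PE; apply: (is_prime1 hF).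
  - move=> x y; have [c <-] := qsurj x; have [d <-] := qsurj y.
    by rewrite -rmorphM => /PE/(is_primeM hF) [] /PE; [left|right].
pose p : prime_idealr R' := prime_pred hP.
have pE c : (q c \in (p : {pred R'})) = (restr F c = 0) :> Prop.
  apply: propext; split=> [/asboolP/PE//|cF].
  exact/asboolP/PE.
have := loc_comp (loc_is_localization p) qsurj.
rewrite (_ : (fun c => _) = (fun c => restr F c = 0)); last exact/funext.
move=> locp.
have kerp c : (loc p \o q) c = 0 <->
    exists u, ~ restr F u = 0 /\ sr_ideal D (u * c).
  by rewrite kerf; split=> -[u [nu Iu]]; exists u; split=> //; rewrite ?pE // -pE.
have dim2 := edge_krull_dim_ge2 locp kerp edge.
apply: (disconnected_not_depth_ge2 locp kerp aX bX aF bF aD bD) (serre p 2%N isT dim2).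
move=> v w vX wX vF wF; apply/negP => vwD; apply: sep.
by exists v, w.
Qed.

End Criterion.

(** * Links in an independence complex *)

Section IndependenceLinks.
Variables (V : finType) (e : rel V).
Hypotheses (e_sym : ssrbool.symmetric e) (e_irr : irreflexive e).
Local Notation D := (independence_complex e).
Implicit Types (F S : {set V}) (x y u v w : V).

Lemma independentP F :
  reflect (forall x y, x \in F -> y \in F -> ~~ e x y) (F \in faces D).
Proof.
rewrite inE; apply: (iffP forall_inP) => [h x y xF|h x xF].
  exact: (forall_inP (h x xF)).
by apply/forall_inP => y; apply: h.
Qed.

Definition alive F x := (x \notin F) && [forall y in F, ~~ e x y].

Lemma aliveP F x : F \in faces D ->
  (x \notin F) && (x |: F \in faces D) = alive F x.
Proof.
move=> FD; rewrite /alive; case: (boolP (x \in F)) => //= xF.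
apply/independentP/forall_inP => [h y yF|h y z].
  by apply: h; rewrite !inE ?eqxx ?yF ?orbT.
rewrite !inE => /predU1P[->|yF] /predU1P[->|zF].
- by rewrite e_irr.
- exact: h.
- by rewrite e_sym; apply: h.
- exact: (independentP _ FD).
Qed.

Lemma alive2P F x y : F \in faces D -> alive F x -> alive F y ->
  (x |: (y |: F) \in faces D) = ~~ e x y.
Proof.
move=> FD ax ay; have yD : y |: F \in faces D.
  by move: ay; rewrite -aliveP // => /andP[].
apply/idP/idP => [/independentP h|nxy].
  by apply: h; rewrite !inE eqxx ?orbT.
have [<-|yx] := eqVneq x y.
  by rewrite setUA setUid; move: ax; rewrite -aliveP // => /andP[].
have ax' : alive (y |: F) x.
  have /andP[xF /forall_inP xN] := ax; rewrite /alive !inE negb_or yx xF /=.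
  by apply/forall_inP => z; rewrite !inE => /predU1P[->//|/xN].
by move: ax'; rewrite -aliveP // => /andP[].
Qed.

(** All vertices on one side of the cut are graph-adjacent to all those on the other. The ends [u],
    [w] of a link edge are on the same side; [v] is taken on the other. *)
Lemma disconnected_link_config F : F \in faces D -> link_has_edge D F ->
  ~ link_connected D F ->
  exists u v w, [/\ alive F u, alive F v & alive F w] /\
    [/\ u != w, ~~ e u w, e v u & e v w] /\
    forall x, alive F x -> e v x || e u x && e w x.
Proof.
move=> FD [u [w [uw uF wF uwD]]] nconn.
have [wD uD] : w |: F \in faces D /\ u |: F \in faces D.
  by split; apply: facesS uwD; rewrite ?subsetUr // setUS // subsetUr.
have au : alive F u by rewrite -aliveP // uF.
have aw : alive F w by rewrite -aliveP // wF.
have neuw : ~~ e u w by rewrite -(alive2P FD).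
apply: contrapT => none; apply: nconn => X a b aX bX aF bF aD bD.
apply: contrapT => sep.
have aa : alive F a by rewrite -aliveP // aF.
have ab : alive F b by rewrite -aliveP // bF.
have eX x y : alive F x -> alive F y -> x \in X -> y \notin X -> e x y.
  move=> ax ay xX yX; apply: contrapT => /negP; rewrite -(alive2P FD) // => xyD.
  apply: sep; exists x, y; split=> //.
    by case/andP: ax.
  by case/andP: ay.
have [uX|uX] := boolP (u \in X).
  have wX : w \in X by apply: contraNT neuw => wX; apply: eX.
  apply: none; exists u, b, w; split=> //; split=> [|x ax].
    by split=> //; rewrite e_sym eX.
  have [xX|xX] := boolP (x \in X); first by rewrite e_sym eX.
  by rewrite [e u x]eX // [e w x]eX // orbT.
have wX : w \notin X by apply: contraNN neuw => wX; rewrite e_sym eX.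
apply: none; exists u, a, w; split=> //; split=> [|x ax].
  by split=> //; rewrite eX.
have [xX|xX] := boolP (x \in X); last by rewrite eX.
by rewrite ![e _ x]e_sym [e x u]eX // [e x w]eX // orbT.
Qed.

(* The link of a suitable face [F] containing [F0] is the independence        *)
(* complex of the graph induced on [S].                                       *)
Lemma isolate_link (S F0 : {set V}) : F0 \in faces D ->
  (forall y, y \in F0 -> y \notin S) ->
  (forall s y, s \in S -> y \in F0 -> ~~ e s y) ->
  (forall s x, s \in S -> x \notin S -> e s x -> exists2 y, y \in F0 & e y x) ->
  exists2 F, F \in faces D & forall x, alive F x = (x \in S).
Proof.
move=> F0D F0S nSF0 bd; pose P F := (F \in faces D) && [disjoint F & S].
have PF0 : P F0.
  by rewrite /P F0D; apply/pred0P => x /=; apply/negP => /andP[/F0S/negPf->].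
have [F /maxsetP[/andP[FD /pred0P FS] Fmax] F0F] := maxset_exists PF0.
have {}FS x : x \in F -> x \notin S by move=> xF; have /= := FS x; rewrite xF /= => ->.
exists F => // x; apply/idP/idP => [/andP[xF /forall_inP nx]|xS].
  apply: contrapT => /negP xS; case/negP: (xF).
  rewrite -(Fmax (x |: F)) ?subsetUr ?setU11 // /P.
  apply/andP; split.
    have : alive F x by rewrite /alive xF; apply/forall_inP.
    by rewrite -aliveP // => /andP[].
  apply/pred0P => z /=; rewrite !inE.
  by case: eqP => [->|_] /=; [exact/negbTE|apply/negP => /andP[/FS/negPf->]].
apply/andP; split; first by apply/negP => /FS; rewrite xS.
apply/forall_inP => y yF; apply/negP => exy.
have [z zF0 ezy] := bd x y xS (FS y yF) exy.
by have /negP := independentP _ FD z y (subsetP F0F z zF0) yF; apply.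
Qed.

(** The graph induced on [S] joins the part in [X] completely to the rest, so no link edge crosses,
    while the nonadjacent [u], [w] supply a link edge. *)
Lemma disconnected_link (S F0 X : {set V}) u w a b : F0 \in faces D ->
  (forall y, y \in F0 -> y \notin S) ->
  (forall s y, s \in S -> y \in F0 -> ~~ e s y) ->
  (forall s x, s \in S -> x \notin S -> e s x -> exists2 y, y \in F0 & e y x) ->
  u \in S -> w \in S -> u != w -> ~~ e u w ->
  a \in S -> b \in S -> a \in X -> b \notin X ->
  (forall x y, x \in S -> y \in S -> x \in X -> y \notin X -> e x y) ->
  exists2 F, F \in faces D & link_has_edge D F /\ ~ link_connected D F.
Proof.
move=> F0D F0S nSF0 bd uS wS uw neuw aS bS aX bX eX.
have [F FD aE] := isolate_link F0D F0S nSF0 bd; exists F => //.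
have inS x : x \in S -> x \notin F /\ x |: F \in faces D.
  by rewrite -aE -aliveP // => /andP[].
split.
  have [uF _] := inS u uS; have [wF _] := inS w wS.
  by exists u, w; split=> //; rewrite (alive2P FD) // aE.
have [aF aD] := inS a aS; have [bF bD] := inS b bS.
move=> /(_ X a b aX bX aF bF aD bD) [x [y [xX yX xF yF xyD]]].
have [xS yS] : x \in S /\ y \in S.
  rewrite -!aE -!aliveP // xF yF; split; apply: facesS xyD.
    by rewrite setUS // subsetUr.
  exact: subsetUr.
by move: xyD; rewrite (alive2P FD) ?aE // eX.
Qed.

End IndependenceLinks.

(** * Finite check on small Cayley graphs *)

Section Bits.
(* The Cayley graph of Z/L with connection set [s]; a bit vector [b] stands   *)
(* for the trace of a face on it, and [bits_bad] for the configuration of     *)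
(* [disconnected_link_config] with v = 0.                                     *)
Local Open Scope nat_scope.

Definition bits_adj (L : nat) (s : seq nat) (i j : nat) : bool :=
  j %% L \in [seq (i + t) %% L | t <- s].

Definition bits_bad (L : nat) (s : seq nat) (b : seq bool) (u w : nat) : bool :=
  let bit i := nth false b (i %% L) in
  let dominated i := has (fun t => bit (i + t)) s in
  [&& all (fun i => bit i ==> ~~ dominated i) (iota 0 L),
      all (fun i => ~~ bit i && ~~ dominated i) [:: 0; u; w],
      u %% L != w %% L, ~~ bits_adj L s u w &
      all (fun x => [|| bit x, dominated x, bits_adj L s 0 x
                      | bits_adj L s u x && bits_adj L s w x]) (iota 0 L)].

Fixpoint all_bits (L : nat) (P : seq bool -> bool) : bool :=
  if L is L'.+1 then
    all_bits L' (fun b => P (true :: b)) && all_bits L' (fun b => P (false :: b))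
  else P [::].

Lemma all_bitsP L P b : all_bits L P -> size b = L -> P b.
Proof.
elim: L P b => [|L IH] P [|c b] //= /andP[ht hf] [szb].
by case: c; [apply: (IH (fun b => P (true :: b)))|apply: (IH (fun b => P (false :: b)))].
Qed.

Definition no_bits_bad (L : nat) (s : seq nat) : bool :=
  all_bits L (fun b => all (fun u => all (fun w => ~~ bits_bad L s b u w) s) s).

(** The components for M = 3, 5, 4, 8. For odd M the group is Z/2M with generator a + n, where a,
    -a, n become M+1, M-1, M; for even M the generator is a and n is M/2. *)
Lemma no_bits_bad_list :
  [&& no_bits_bad 6 [:: 4; 2; 3], no_bits_bad 10 [:: 6; 4; 5],
      no_bits_bad 4 [:: 1; 3; 2] & no_bits_bad 8 [:: 1; 7; 4]].
Proof. by vm_compute. Qed.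

End Bits.

(** * From the finite check to links in a Cayley graph *)

Section CayleyComponent.
Variables (Z : finZmodType) (e : rel Z).
Hypotheses (e_sym : ssrbool.symmetric e) (e_irr : irreflexive e).
Variables (g : Z) (L : nat) (s : seq nat).
Hypothesis L_gt0 : (0 < L)%N.
Hypothesis gE : forall i j, (g *+ i == g *+ j) = (i == j %[mod L])%N.
Hypothesis eE : forall x y, e x y = has (fun t => y == x + g *+ t) s.
Local Notation D := (independence_complex e).

Lemma component_adj v i j : e (v + g *+ i) (v + g *+ j) = bits_adj L s i j.
Proof.
rewrite eE /bits_adj; apply/hasP/mapP => -[t ts tE]; exists t => //; move: tE.
  by rewrite -addrA -mulrnDr (inj_eq (addrI v)) gE => /eqP.
by rewrite -addrA -mulrnDr (inj_eq (addrI v)) gE => ->.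
Qed.

(** The forbidden configuration consists of [v] and two of its neighbours, so after translating [v]
    to 0 it is visible in the trace of [F] on the single coset [v + <g>]. *)
Lemma component_connected F : no_bits_bad L s -> F \in faces D ->
  link_has_edge D F -> link_connected D F.
Proof.
move=> nbad FD edge; apply: contrapT => nconn.
have [u [v [w [[au av aw] [[uw neuw vu vw] cov]]]]] :=
  disconnected_link_config e_sym e_irr FD edge nconn.
pose phi i := v + g *+ i; pose b := [seq phi i \in F | i <- iota 0 L].
have bitE i : nth false b (i %% L)%N = (phi i \in F).
  have iL : (i %% L < L)%N by rewrite ltn_mod.
  rewrite (nth_map 0%N) ?size_iota // nth_iota // add0n; congr (v + _ \in F).
  by apply/eqP; rewrite gE modn_mod.
have domE i : has (fun t => nth false b ((i + t) %% L)%N) s =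
    [exists y in F, e (phi i) y].
  apply/hasP/exists_inP => [[t ts]|[y yF]]; rewrite ?bitE.
    move=> tF; exists (phi (i + t)%N) => //; rewrite eE; apply/hasP; exists t => //.
    by rewrite /phi mulrnDr addrA.
  rewrite eE => /hasP[t ts /eqP yE]; exists t => //.
  by rewrite bitE /phi mulrnDr addrA -yE.
have aliveE i : ~~ nth false b (i %% L)%N &&
    ~~ has (fun t => nth false b ((i + t) %% L)%N) s = alive e F (phi i).
  by rewrite bitE domE /alive negb_exists; congr andb; apply: eq_forallb => y;
     rewrite negb_and implybE.
have phi0 : phi 0%N = v by rewrite /phi mulr0n addr0.
have nbr x : e v x -> exists2 t, t \in s & x = phi t.
  by rewrite eE => /hasP[t ts /eqP ->]; exists t.
have [tu us uE] := nbr u vu; have [tw ws wE] := nbr w vw.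
have := all_bitsP nbad (b := b); rewrite size_map size_iota => /(_ erefl).
move=> /allP/(_ tu us)/allP/(_ tw ws)/negP; apply.
rewrite /bits_bad -(component_adj v) -/(phi tu) -/(phi tw) -uE -wE neuw.
apply/and5P; split=> //.
- apply/allP => i _; apply/implyP; rewrite bitE domE => iF.
  by apply/exists_inP => -[y yF]; apply/negP/(independentP _ _ FD).
- by rewrite /= !aliveE phi0 -uE -wE au av aw.
- by move: uw; rewrite uE wE (inj_eq (addrI v)) gE.
apply/allP => i _; rewrite -!(component_adj v) -/(phi tu) -/(phi tw) -/(phi i).
rewrite -uE -wE -/(phi 0%N) phi0 orbA.
case: (boolP (alive e F (phi i))) => [/cov ->|]; first by rewrite !orbT.
by rewrite -aliveE negb_and !negbK => ->.
Qed.

End CayleyComponent.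

(** * Links in the cubic circulant graph *)

Section CubicCirculant.
Variables (Z : finZmodType) (e : rel Z) (a n : Z) (M : nat).
Hypothesis eE : forall x y, e x y = [|| y == x + a, y == x - a | y == x + n].
Hypotheses (n_neq0 : n != 0) (nn0 : n + n = 0) (an : a != n).
Hypothesis tor2 : forall x, x + x = 0 -> x = 0 \/ x = n.
Hypotheses (M_gt0 : (0 < M)%N) (aM : forall i, (a *+ i == 0) = (M %| i)%N).
Hypothesis a_neq0 : a != 0.
Local Notation D := (independence_complex e).

Lemma circ_sym : ssrbool.symmetric e.
Proof.
suff h x y : e x y -> e y x by move=> x y; apply/idP/idP; apply: h.
rewrite !eE => /or3P[] /eqP ->.
- by rewrite addrK eqxx orbT.
- by rewrite addrNK eqxx.
- by rewrite -[x + n + n]addrA nn0 addr0 eqxx !orbT.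
Qed.

Lemma circ_irr : irreflexive e.
Proof.
move=> x; rewrite eE -{1}[x]addr0 -{3}[x]addr0 -{5}[x]addr0 !(inj_eq (addrI x)).
by rewrite ![0 == _]eq_sym oppr_eq0 (negPf n_neq0) (negPf a_neq0).
Qed.

Lemma mulrn_eq i j : (a *+ i == a *+ j) = (i == j %[mod M])%N.
Proof.
wlog ij : i j / (i <= j)%N => [h|].
  by have [/h//|/ltnW/h] := leqP i j; rewrite eq_sym => ->; rewrite eq_sym.
by rewrite eq_sym -subr_eq0 -mulrnBr // aM eq_sym eqn_mod_dvd.
Qed.

Lemma M_gt2 : (2 < M)%N.
Proof.
move: M_gt0 aM; case: M => [|[|[|]]] // _ h.
  by move: (h 1%N); rewrite mulr1n dvdnn (negPf a_neq0).
have : a + a = 0 by apply/eqP; rewrite -mulr2n h.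
by case/tor2 => [/eqP|/eqP]; rewrite ?(negPf an) ?(negPf a_neq0).
Qed.

Lemma half_order h : M = (2 * h)%N -> n = a *+ h.
Proof.
move=> Mh; have h0 : (0 < h)%N by have := M_gt2; rewrite Mh; case: (h).
have : a *+ h + a *+ h = 0 by apply/eqP; rewrite -mulrnDr aM addnn -mul2n Mh.
case/tor2 => [/eqP|//]; rewrite aM Mh => /(dvdn_leq h0).
by rewrite -{2}[h]mul1n leq_pmul2r.
Qed.

Lemma mulrn_eq_n k : a *+ k = n -> (M %| 2 * k)%N /\ ~~ (M %| k)%N.
Proof.
by move=> kn; rewrite -!aM kn mulnC mulrnA kn mulr2n nn0 eqxx n_neq0.
Qed.

(** The orders M of [a] and 2 of [n] are coprime, so [a + n] has order 2M. *)
Lemma odd_gen_order : odd M -> forall i j,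
  ((a + n) *+ i == (a + n) *+ j) = (i == j %[mod 2 * M])%N.
Proof.
move=> oM i j; have Mn : n *+ M = n.
  by rewrite -[M]odd_double_half oM -mul2n mulrnDr mulrnA mulr2n nn0 mul0rn addr0.
have order k : ((a + n) *+ k == 0) = (2 * M %| k)%N.
  rewrite Gauss_dvd ?coprime2n // mulrnDl.
  apply/eqP/andP => [e0|[k2 kM]]; last first.
    have /eqP -> : a *+ k == 0 by rewrite aM.
    by rewrite -(divnK k2) mulnC mulrnA mulr2n nn0 mul0rn addr0.
  have kM : (M %| k)%N.
    rewrite -(@Gauss_dvdr M 2) ?coprimen2 // -aM mulnC mulrnA mulr2n.
    have -> : a *+ k = - (n *+ k) by apply/eqP; rewrite -addr_eq0 e0.
    by rewrite -opprD -mulrnDl nn0 mul0rn oppr0.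
  split=> //; move: e0; have /eqP -> : a *+ k == 0 by rewrite aM.
  rewrite add0r -{1}[k]odd_double_half -mul2n mulrnDr mulrnA mulr2n nn0 mul0rn.
  rewrite addr0 dvdn2.
  by case: (odd k) => //= /eqP; rewrite mulr1n (negPf n_neq0).
wlog ij : i j / (i <= j)%N => [h|].
  by have [/h//|/ltnW/h] := leqP i j; rewrite eq_sym => ->; rewrite eq_sym.
by rewrite eq_sym -subr_eq0 -mulrnBr // order eq_sym eqn_mod_dvd.
Qed.

Lemma circ_connected F : M \in [:: 3; 4; 5; 8]%N -> F \in faces D ->
  link_has_edge D F -> link_connected D F.
Proof.
move=> Mgood; have oppM : - a = a *+ M.-1.
  apply/eqP; rewrite eq_sym -addr_eq0 -mulrSr prednK // aM dvdnn //.
have /and4P[nb6 nb10 nb4 nb8] := no_bits_bad_list.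
have even_case h : M = (2 * h)%N -> no_bits_bad M [:: 1; M.-1; h]%N ->
    F \in faces D -> link_has_edge D F -> link_connected D F.
  move=> Mh nb; apply: (component_connected circ_sym circ_irr M_gt0 mulrn_eq _ nb).
  by move=> x y; rewrite eE oppM (half_order Mh) /= mulr1n orbF.
have odd_case : odd M -> no_bits_bad (2 * M) [:: M.+1; M.-1; M]%N ->
    F \in faces D -> link_has_edge D F -> link_connected D F.
  move=> oM nb; have M0 : (0 < 2 * M)%N by rewrite muln_gt0.
  apply: (component_connected circ_sym circ_irr M0 (odd_gen_order oM) _ nb).
  have aM0 : a *+ M = 0 by apply/eqP; rewrite aM.
  have Mn : n *+ M = n.
    by rewrite -[M]odd_double_half oM -mul2n mulrnDr mulrnA mulr2n nn0 mul0rn addr0.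
  have gM : (a + n) *+ M = n by rewrite mulrnDl aM0 Mn add0r.
  have gM1 : (a + n) *+ M.-1 = - a.
    by apply: (addIr (a + n)); rewrite addKr -mulrSr (prednK M_gt0) gM.
  by move=> x y; rewrite eE /= mulrSr gM gM1 orbF [n + _]addrCA nn0 addr0.
move: Mgood even_case odd_case; rewrite !inE.
case/or4P => /eqP ->; first by move=> _ /(_ isT nb6).
- by move=> /(_ 2%N erefl nb4).
- by move=> _ /(_ isT nb10).
- by move=> /(_ 4%N erefl nb8).
Qed.

(** Here n = 3a, so two multiples of a are adjacent exactly when their indices differ in parity: the
    component is K_{3,3}, with [X] its even half. *)
Lemma circ_disconnected6 : M = 6%N ->
  exists2 F, F \in faces D & link_has_edge D F /\ ~ link_connected D F.
Proof.
move=> M6; have n3 : n = a *+ 3 by apply: half_order.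
have oppM : - a = a *+ 5.
  by apply/eqP; rewrite eq_sym -addr_eq0 -mulrSr aM M6.
have eE' x y : e x y = has (fun t => y == x + a *+ t) [:: 1; 5; 3]%N.
  by rewrite eE oppM n3 /= mulr1n orbF.
have adj i j : e (a *+ i) (a *+ j) = bits_adj 6 [:: 1; 5; 3] i j.
  by have := component_adj mulrn_eq eE' 0 i j; rewrite !add0r M6.
pose S := [set a *+ i | i : 'I_6]; pose X := [set a *+ i | i : 'I_6 & ~~ odd i].
have SP k : a *+ k \in S.
  apply/imsetP; exists (inord (k %% 6)) => //.
  by apply/eqP; rewrite inordK ?ltn_mod // mulrn_eq M6 modn_mod.
have odd6 k : odd (k %% 6) = odd k by rewrite odd_mod.
have XP k : (a *+ k \in X) = ~~ odd k.
  apply/imsetP/idP => [[i + /eqP]|ek].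
    by rewrite inE mulrn_eq M6 => oi /eqP/(congr1 odd); rewrite !odd6 => ->.
  exists (inord (k %% 6)); rewrite ?inE ?inordK ?ltn_mod ?odd6 //.
  by apply/eqP; rewrite mulrn_eq M6 modn_mod.
apply: (@disconnected_link _ e circ_sym circ_irr S set0 X
          (a *+ 0) (a *+ 2) (a *+ 0) (a *+ 1)); rewrite ?SP ?XP ?adj //.
- by apply/independentP => x y; rewrite inE.
- by move=> y; rewrite inE.
- by move=> u y _; rewrite inE.
- move=> _ x /imsetP[i _ ->] xS; rewrite eE' => /hasP[t _ /eqP xE].
  by rewrite xE -mulrnDr SP in xS.
- by rewrite mulrn_eq M6.
move=> _ _ /imsetP[i _ ->] /imsetP[j _ ->]; rewrite !XP adj.
by case: i j => -[|[|[|[|[|[|//]]]]]] ? [[|[|[|[|[|[|//]]]]]] ?].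
Qed.

Lemma circ_disconnected_large : (6 < M)%N -> M != 8%N ->
  exists2 F, F \in faces D & link_has_edge D F /\ ~ link_connected D F.
Proof.
move=> M_gt6 M8; pose P i (j : bool) := a *+ i + n *+ j.
have small k : (0 < k < 7)%N -> (a *+ k == 0) = false.
  case/andP=> k0 k7; rewrite aM; apply/negP => /(dvdn_leq k0) Mk.
  by have := leq_trans M_gt6 Mk; rewrite leqNgt ltnS -ltnS k7.
(* If n = ka then M divides 2k but not k; as 2k is at most 8 and M > 6, this leaves only M = 8,
   which is excluded. *)
have smalln k : (k < 5)%N -> (a *+ k == n) = false.
  move=> k5; apply/negP => /eqP/mulrn_eq_n[M2k nMk].
  have k0 : (0 < k)%N by rewrite lt0n; apply: contraNneq nMk => ->.
  have /dvdnP[[|[|q]] qE] := M2k; first by lia.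
    by lia.
  by nia.
have Pinj i j i' j' : (i <= i')%N -> (i' < i + 5 + (j == j'))%N ->
    (P i' j' == P i j) = (i == i') && (j == j').
  move=> ii' di; rewrite /P -subr_eq0 opprD addrACA -mulrnBr //.
  have [jj|jj] := eqVneq j j'.
    rewrite jj subrr addr0 andbT; have [->|ne] := eqVneq i i'.
      by rewrite subnn mulr0n eqxx.
    by apply: small; rewrite jj eqxx in di; lia.
  have nN : - n = n by apply: (addrI n); rewrite subrr nn0.
  rewrite andbF -(smalln (i' - i)%N); last by rewrite (negPf jj) in di; lia.
  have -> : n *+ j' - n *+ j = n.
    move: jj; case: j {di}; case: j' => //= _; rewrite ?mulr0n ?mulr1n ?subr0 //.
    by rewrite add0r nN.
  by rewrite addr_eq0 nN.
have Pd i j i' j' : (i < i' + 5 + (j == j'))%N -> (i' < i + 5 + (j == j'))%N ->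
    (P i j == P i' j') = (i == i') && (j == j').
  move=> h h'; have [ii'|/ltnW i'i] := leqP i i'; first by rewrite eq_sym Pinj.
  by have := @Pinj i' j' i j i'i; rewrite [j' == j]eq_sym [i' == i]eq_sym; apply.
have PS i j : P i j + a = P i.+1 j by rewrite /P mulrSr addrAC.
have Pn i j : P i j + n = P i (~~ j).
  by rewrite /P; case: j; rewrite ?mulr0n ?mulr1n ?addr0 // -addrA nn0 addr0.
have Pe i j i' j' : e (P i j) (P i' j') =
    [|| P i' j' == P i.+1 j, P i j == P i'.+1 j' | P i' j' == P i (~~ j)].
  by rewrite eE PS Pn [P i' j' == P i j - a]eq_sym subr_eq PS.
(* The claw centred at 2a, a translate that keeps the indices natural. Every neighbour of a leaf
   outside the claw is adjacent to n or to 4a + n. *)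
pose S := [set P 2 false; P 1 false; P 3 false; P 2 true].
pose F0 := [set P 0 true; P 4 true].
have nbr i j x : e (P i.+1 j) x ->
    [\/ x = P i j, x = P i.+2 j | x = P i.+1 (~~ j)].
  rewrite eE PS Pn => /or3P[] /eqP->; [by constructor 2| |by constructor 3].
  by constructor 1; rewrite -PS addrK.
apply: (@disconnected_link _ e circ_sym circ_irr S F0 [set P 2 false]
          (P 1 false) (P 3 false) (P 2 false) (P 1 false)).
- apply/independentP => x y; rewrite !inE.
  by move=> /orP[]/eqP-> /orP[]/eqP->; rewrite Pe !Pd.
- by move=> y; rewrite !inE => /orP[]/eqP->; rewrite !Pd.
- move=> s y; rewrite !inE -!orbA.
  by move=> /or4P[] /eqP-> /orP[]/eqP->; rewrite Pe !Pd.
- move=> s x; rewrite !inE -!orbA => /or4P[] /eqP-> xS /nbr[] xE;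
  move: xS; rewrite {}xE !Pd //= => _.
  + by exists (P 0 true); rewrite ?inE ?eqxx ?orbT // Pe !Pd.
  + by exists (P 0 true); rewrite ?inE ?eqxx ?orbT // Pe !Pd.
  + by exists (P 4 true); rewrite ?inE ?eqxx ?orbT // Pe !Pd.
  + by exists (P 4 true); rewrite ?inE ?eqxx ?orbT // Pe !Pd.
  + by exists (P 0 true); rewrite ?inE ?eqxx ?orbT // Pe !Pd.
  + by exists (P 4 true); rewrite ?inE ?eqxx ?orbT // Pe !Pd.
- by rewrite !inE eqxx ?orbT.
- by rewrite !inE eqxx ?orbT.
- by rewrite Pd.
- by rewrite Pe !Pd.
- by rewrite !inE eqxx ?orbT.
- by rewrite !inE eqxx ?orbT.
- by rewrite inE.
- by rewrite inE Pd.
move=> x y; rewrite !inE => _ + /eqP-> ; rewrite -!orbA.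
by move=> /or4P[] /eqP->; rewrite ?eqxx // Pe !Pd.
Qed.

End CubicCirculant.

(** * The circulant graph on Z/2n *)

Section CirculantZp.
Variables (p n a : nat).
Hypotheses (pE : p.+2 = (2 * n)%N) (ha : (1 <= a < n)%N).
Local Notation Z := 'I_p.+2.
Local Notation za := (inZp a : Z).
Local Notation zn := (inZp n : Z).

Lemma inZp_addE (x y : Z) b : (b < p.+2)%N ->
  (y == x + inZp b) = (y == x + b :> nat)%N || (y + p.+2 == x + b :> nat)%N.
Proof.
move=> bp; rewrite -val_eqE /= modnDmr.
have [xb|xb] := ltnP (x + b) p.+2; first by rewrite modn_small //; lia.
have -> : ((x + b) %% p.+2 = x + b - p.+2)%N.
  by rewrite -{1}(subnK xb) modnDr modn_small //; have := ltn_ord x; lia.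
by have := ltn_ord y; lia.
Qed.

Lemma circulant_ZpE (x y : Z) :
  circulant p.+2 [:: a; n] x y = [|| y == x + za, y == x - za | y == x + zn].
Proof.
have [a0 an] := andP ha; rewrite [y == x - za]eq_sym subr_eq.
rewrite !inZp_addE; try lia.
rewrite /circulant /dist !inE; have := ltn_ord x; have := ltn_ord y.
by case: (leqP x y) => ? ? ?; lia.
Qed.

(** The order of a in Z/2n: dividing by the gcd leaves coprime numbers, and Gauss's lemma
    applies. *)
Lemma inZp_mulrn_eq0 i : (za *+ i == 0) = (p.+2 %/ gcdn a p.+2 %| i)%N.
Proof.
have g0 : (0 < gcdn a p.+2)%N by rewrite gcdn_gt0 orbT.
rewrite Zp_mulrn -val_eqE /= modnMml -/(dvdn _ _).
rewrite -[in X in (X %| _)%N](divnK (dvdn_gcdr a p.+2)).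
rewrite -[in X in (_ %| X * i)%N](divnK (dvdn_gcdl a p.+2)) mulnAC dvdn_pmul2r //.
rewrite Gauss_dvdr // /coprime -(eqn_pmul2r g0) mul1n muln_gcdl.
by rewrite !divnK ?dvdn_gcdl ?dvdn_gcdr // gcdnC.
Qed.

Lemma circulant_serre2 (k : fieldType) :
  graph_serre2 k (circulant p.+2 [:: a; n]) <->
  (p.+2 %/ gcdn a p.+2)%N \in [:: 3; 4; 5; 8]%N.
Proof.
have [a0 an] := andP ha; set M := (p.+2 %/ _)%N.
have n0 : zn != 0 by rewrite -val_eqE /= modn_small; lia.
have nn0 : zn + zn = 0.
  by apply: val_inj; rewrite /= modnDm addnn -mul2n -pE modnn.
have a_n : za != zn by rewrite -val_eqE /= !modn_small; lia.
have za0 : za != 0 by rewrite -val_eqE /= modn_small; lia.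
have tor2 (x : Z) : x + x = 0 -> x = 0 \/ x = zn.
  move=> /(congr1 val) /= /eqP xx; have : (2 * n %| x + x)%N by rewrite -pE.
  have xlt : (x < 2 * n)%N by rewrite -pE.
  rewrite addnn -mul2n dvdn_pmul2l // => /dvdnP[q xE]; rewrite xE in xlt.
  have [q0|q1] : q = 0%N \/ q = 1%N by nia.
    by left; apply: val_inj; rewrite /= xE q0.
  by right; apply: val_inj; rewrite /= xE q1 mul1n modn_small; lia.
have M0 : (0 < M)%N by rewrite divn_gt0 ?gcdn_gt0 ?orbT // dvdn_leq // dvdn_gcdr.
split=> [/serre2P conn|good]; last first.
  apply/serre2P => F.
  exact: (circ_connected circulant_ZpE n0 nn0 a_n tor2 M0 inZp_mulrn_eq0 za0 good).
(* Since M > 2, the values left are 6 and those above 6 other than 8. *)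
have M2 := M_gt2 a_n tor2 M0 inZp_mulrn_eq0 za0.
apply: contrapT => /negP; rewrite !inE !negb_or => /and4P[M3 M4 M5 M8].
set D := independence_complex _ in conn *.
have [F FD [edge]] : exists2 F, F \in faces D &
    link_has_edge D F /\ ~ link_connected D F.
  have [M6|M6] := eqVneq M 6%N.
    exact: (circ_disconnected6 circulant_ZpE n0 nn0 a_n tor2 M0 inZp_mulrn_eq0 za0 M6).
  apply: (circ_disconnected_large circulant_ZpE n0 nn0 a_n M0 inZp_mulrn_eq0 za0) => //.
  by lia.
by apply; apply: conn.
Qed.

End CirculantZp.

Local Close Scope ring_scope.

Theorem theorem6p6 (k : fieldType) (n a : nat) (ha : 1 <= a < n) :
  graph_serre2 k (circulant (2 * n) [:: a; n]) <->
  (2 * n) %/ gcdn a (2 * n) \in [:: 3; 4; 5; 8].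
Proof.
have [p pE] : exists p, 2 * n = p.+2 by exists (2 * n - 2); lia.
by rewrite pE; apply: circulant_serre2 (esym pE) ha k.
Qed.
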